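(* Let $u:\mathfrak{g}_\lambda\to\mathfrak{g}_\lambda$ be a linear isomorphism that is $\mathbf{k}_\lambda$-symmetric. If $u$ leaves stable either the center $C(\mathfrak{g}_\lambda)$ of $\mathfrak{g}_\lambda$ (and a fortiori its derived ideal) or some Cartan subalgebra of $\mathfrak{g}_\lambda$, then the left-invariant pseudo-Riemannian metric $\mathbf{k}_u$ on $G_\lambda$ is (geodesically) complete.
   Context: Let $n\ge 1$ and $\lambda=(\lambda_1,\ldots,\lambda_n)\in\mathbb{R}^n$ with $0<\lambda_1\le\cdots\le\lambda_n$. The oscillator group $G_\lambda$ is the simply connected Lie group with underlying manifold $\mathbb{R}\times\mathbb{R}\times\mathbb{C}^n$ and product $$(t,s,z_1,\ldots,z_n)\cdot(t',s',z'_1,\ldots,z'_n)=\Big(t+t',\,s+s'+\tfrac12\sum_{j=1}^n\mathrm{Im}(\bar z_j e^{it\lambda_j}z'_j),\,\ldots,z_j+e^{it\lambda_j}z'_j,\ldots\Big).$$ Its Lie algebra $\mathfrak{g}_\lambda$ (dimension $2n+2$) has basis $e_{-1},e_0,e_1,\ldots,e_n,\check e_1,\ldots,\check e_n$ with brackets $[e_{-1},e_j]=\lambda_j\check e_j$, $[e_j,\check e_j]=e_0$, $[e_{-1},\check e_j]=-\lambda_j e_j$, the other brackets being zero or deduced by antisymmetry. For $x=\sum_{j=-1}^n x_je_j+\sum_{j=1}^n\check x_j\check e_j$, the nondegenerate ad-invariant symmetric bilinear form $\mathbf{k}_\lambda$ is given by $\mathbf{k}_\lambda(x,x)=2x_{-1}x_0+\sum_{j=1}^n\frac1{\lambda_j}(x_j^2+\check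 x_j^2)$. A linear isomorphism $u$ of $\mathfrak{g}_\lambda$ is $\mathbf{k}_\lambda$-symmetric if $\mathbf{k}_\lambda(u(x),y)=\mathbf{k}_\lambda(x,u(y))$ for all $x,y$; then $\mathbf{k}_u$ denotes the left-invariant pseudo-Riemannian metric on $G_\lambda$ whose value at the identity is $\mathbf{k}_u(x,y)=\mathbf{k}_\lambda(u(x),y)$. Complete means that all geodesics of the Levi-Civita connection are defined on all of $\mathbb{R}$. *)

(* Defs.v *)
From HB Require Import structures.
From mathcomp Require Import all_boot all_order all_algebra.
From mathcomp Require Import all_classical all_reals all_analysis.
From mathcomp Require Import complex ring.

Set Implicit Arguments.
Unset Strict Implicit.
Unset Printing Implicit Defensive.

Import Order.TTheory GRing.Theory Num.Theory.
Import numFieldNormedType.Exports.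

Local Open Scope classical_set_scope.
Local Open Scope ring_scope.

(** * Pseudo-Riemannian geometry of R^N in its global chart *)

Section PseudoRiemannian.
Variables (R : realType) (N : nat).
Implicit Types (g : 'rV[R]_N -> 'M[R]_N) (c : R -> 'rV[R]_N) (I : set R).

(** A metric is given by its Gram matrices g_ij(p) in the coordinate frame;
    [partial i f] is the i-th partial derivative of f. *)
Definition partial (i : 'I_N) (f : 'rV[R]_N -> R) (p : 'rV[R]_N) : R :=
  'D_(delta_mx 0 i) f p.

(** Christoffel symbol Gamma^k_ij of the Levi-Civita connection of g. *)
Definition christoffel g (k i j : 'I_N) (p : 'rV[R]_N) : R :=
  2^-1 * \sum_(l < N) invmx (g p) k l *
    (partial i (fun q => g q j l) p + partial j (fun q => g q i l) p
     - partial l (fun q => g q i j) p).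

Definition geodesic_on g I c : Prop :=
  forall t, I t ->
    [/\ derivable c t 1, derivable (derive1 c) t 1 &
      forall k : 'I_N,
        derive1 (derive1 c) t 0 k
        + \sum_(i < N) \sum_(j < N)
            christoffel g k i j (c t) * derive1 c t 0 i * derive1 c t 0 j = 0].

(** Every geodesic, on whatever open interval it is given, is the restriction
    of a geodesic defined on the whole real line. *)
Definition geodesically_complete g : Prop :=
  forall I c, open I -> is_interval I -> geodesic_on g I c ->
    exists c', geodesic_on g setT c' /\ forall t, I t -> c' t = c t.

End PseudoRiemannian.

(** * The oscillator group and its Lie algebra

    Both are carried by row vectors of length 2n+2: the coordinates are
    (t, s, Re z_1, .., Re z_n, Im z_1, .., Im z_n) on the group and
    (x_{-1}, x_0, x_1, .., x_n, x^_1, .., x^_n) on the Lie algebra.  Thus the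
    Lie algebra is the tangent space at the identity, e_j being the coordinate
    vector of Re z_j and the checked e_j that of Im z_j. *)

Notation osc_dim n := (1 + 1 + (n + n))%N.
Notation osc R n := 'rV[R]_(osc_dim n).

Section Oscillator.
Variables (R : realType) (n : nat).
Implicit Types (lam : 'I_n -> R) (x y p q : osc R n) (j : 'I_n).
Implicit Types (U V h : {vspace osc R n}).

Local Open Scope complex_scope.

Definition mkosc (a b : R) (e e' : 'I_n -> R) : osc R n :=
  row_mx (row_mx (const_mx a) (const_mx b))
         (row_mx (\row_j e j) (\row_j e' j)).

(** [x_m1], [x_0], [x_e], [x_e'] stand for x_{-1}, x_0, x_j, x^_j. *)
Definition x_m1 x : R := x 0 (lshift (n + n) (lshift 1 ord0)).
Definition x_0 x : R := x 0 (lshift (n + n) (rshift 1 ord0)).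
Definition x_e x j : R := x 0 (rshift (1 + 1) (lshift n j)).
Definition x_e' x j : R := x 0 (rshift (1 + 1) (rshift n j)).

Definition zcoord p j : R[i] := x_e p j +i* x_e' p j.

Definition mkoscC (t s : R) (z : 'I_n -> R[i]) : osc R n :=
  mkosc t s (fun j => complex.Re (z j)) (fun j => complex.Im (z j)).

Definition expi (a : R) : R[i] := cos a +i* sin a.

Definition omul lam p q : osc R n :=
  mkoscC (x_m1 p + x_m1 q)
    (x_0 p + x_0 q + 2^-1 * \sum_(j < n)
       complex.Im ((zcoord p j)^* * expi (x_m1 p * lam j) * zcoord q j))
    (fun j => zcoord p j + expi (x_m1 p * lam j) * zcoord q j).

Definition oinv lam p : osc R n :=
  mkoscC (- x_m1 p) (- x_0 p)
    (fun j => - (expi (- (x_m1 p * lam j)) * zcoord p j)).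

(** The bilinear bracket for which [e_{-1}, e_j] = lambda_j e^_j,
    [e_{-1}, e^_j] = - lambda_j e_j and [e_j, e^_j] = e_0. *)
Definition lie lam x y : osc R n :=
  mkosc 0
    (\sum_(j < n) (x_e x j * x_e' y j - x_e' x j * x_e y j))
    (fun j => - lam j * (x_m1 x * x_e' y j - x_e' x j * x_m1 y))
    (fun j => lam j * (x_m1 x * x_e y j - x_e x j * x_m1 y)).

(** Polar form of 2 x_{-1} x_0 + sum_j (x_j^2 + x^_j^2) / lambda_j. *)
Definition kform lam x y : R :=
  x_m1 x * x_0 y + x_0 x * x_m1 y
  + \sum_(j < n) (lam j)^-1 * (x_e x j * x_e y j + x_e' x j * x_e' y j).

Definition k_symmetric lam (u : osc R n -> osc R n) : Prop :=
  forall x y, kform lam (u x) y = kform lam x (u y).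

Definition leaves_stable (u : osc R n -> osc R n) (A : set (osc R n)) : Prop :=
  u @` A `<=` A.

Definition lie_center lam : set (osc R n) :=
  [set x | forall y, lie lam x y = 0].

Definition lie_vs lam U V : {vspace osc R n} :=
  <<[seq lie lam x y | x <- vbasis U, y <- vbasis V]>>%VS.

Definition derived_ideal lam : {vspace osc R n} := lie_vs lam fullv fullv.

Definition lie_subalgebra lam h : Prop := (lie_vs lam h h <= h)%VS.

Definition lie_nilpotent lam h : Prop :=
  exists k, iter k (lie_vs lam h) h = 0%VS.

Definition lie_normalizer lam h : set (osc R n) :=
  [set x | forall y, y \in h -> lie lam x y \in h].

Definition cartan_subalgebra lam h : Prop :=
  [/\ lie_subalgebra lam h, lie_nilpotent lam h &
      lie_normalizer lam h = [set` h]].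

(** k_u at p: tangent vectors at p are moved to the identity by the
    differential at p of left translation by p^-1. *)
Definition ku_metric lam (u : osc R n -> osc R n) p : 'M[R]_(osc_dim n) :=
  \matrix_(i, j)
    kform lam (u ('D_(delta_mx 0 i) (omul lam (oinv lam p)) p))
              ('D_(delta_mx 0 j) (omul lam (oinv lam p)) p).

(** ** Group law: [oinv] is the inverse for [omul] *)

Lemma mkoscK a b e e' :
  [/\ x_m1 (mkosc a b e e') = a, x_0 (mkosc a b e e') = b,
      x_e (mkosc a b e e') =1 e & x_e' (mkosc a b e e') =1 e'].
Proof.
rewrite /x_m1 /x_0 /x_e /x_e' /mkosc; split=> [||j|j];
  by rewrite ?row_mxEl ?row_mxEr ?row_mxEl ?row_mxEr !mxE.
Qed.

Lemma x_m1_mk a b e e' : x_m1 (mkosc a b e e') = a.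
Proof. by case: (mkoscK a b e e'). Qed.

Lemma x_0_mk a b e e' : x_0 (mkosc a b e e') = b.
Proof. by case: (mkoscK a b e e'). Qed.

Lemma x_e_mk a b e e' j : x_e (mkosc a b e e') j = e j.
Proof. by case: (mkoscK a b e e'). Qed.

Lemma x_e'_mk a b e e' j : x_e' (mkosc a b e e') j = e' j.
Proof. by case: (mkoscK a b e e'). Qed.

Definition mkE := (x_m1_mk, x_0_mk, x_e_mk, x_e'_mk).

Lemma osc_eqP x y : x_m1 x = x_m1 y -> x_0 x = x_0 y -> x_e x =1 x_e y ->
  x_e' x =1 x_e' y -> x = y.
Proof.
move=> h1 h2 h3 h4; apply/rowP => i; case: (splitP i) => k ik.
  case: (splitP k) => l kl.
    have -> : i = lshift (n + n) (lshift 1 ord0) by apply/val_inj; rewrite /= ik kl; case: l {kl} => -[].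
    exact: h1.
  have -> : i = lshift (n + n) (rshift 1 ord0) by apply/val_inj; rewrite /= ik kl; case: l {kl} => -[].
  exact: h2.
case: (splitP k) => l kl.
  have -> : i = rshift (1 + 1) (lshift n l) by apply/val_inj; rewrite /= ik kl.
  exact: h3.
have -> : i = rshift (1 + 1) (rshift n l) by apply/val_inj; rewrite /= ik kl.
exact: h4.
Qed.

Lemma omul0r lam p : omul lam 0 p = p.
Proof.
apply: osc_eqP => [||j|j]; rewrite /omul /mkoscC ?mkE /x_m1 /x_0 /zcoord /x_e /x_e' !mxE /= ?mul0r ?cos0 ?sin0 /=.
- by rewrite add0r.
- by rewrite add0r big1 ?mulr0 ?addr0 // => j _; rewrite !mxE /=; ring.
- by ring.
- by ring.
Qed.

Lemma omulA lam p q x : omul lam p (omul lam q x) = omul lam (omul lam p q) x.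
Proof.
apply: osc_eqP => [||j|j]; rewrite /omul /mkoscC ?mkE.
- by rewrite addrA.
- rewrite -!addrA; congr (_ + (_ + _)); rewrite [RHS]addrCA; congr (_ + _).
  rewrite -!mulrDr -!big_split /=; congr (_ * _).
  apply: eq_bigr => j _; rewrite !mkE /= (mulrDl (x_m1 p) (x_m1 q)) cosD sinD.
  rewrite /zcoord ?mkE /=; have := cos2Dsin2 (x_m1 p * lam j).
  set a := cos (x_m1 p * _); set b := sin (x_m1 p * _) => hab.
  set z1 := x_e q j; set z2 := x_e' q j.
  set c := cos _; set d := sin _; set w1 := x_e x j; set w2 := x_e' x j.
  apply: subr0_eq.
  rewrite [LHS](_ : _ = (1 - (a ^+ 2 + b ^+ 2)) *
    (z1 * (c * w2 + d * w1) - z2 * (c * w1 - d * w2))); last by ring.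
  by rewrite hab subrr mul0r.
- rewrite /zcoord !mkE /= (mulrDl (x_m1 p) (x_m1 q)) cosD sinD; ring.
- rewrite /zcoord !mkE /= (mulrDl (x_m1 p) (x_m1 q)) cosD sinD; ring.
Qed.

Lemma omulVr lam p : omul lam (oinv lam p) p = 0.
Proof.
apply: osc_eqP => [||j|j]; rewrite /omul /oinv /mkoscC !mkE ?mulNr.
- by rewrite addNr /x_m1 mxE.
- rewrite addNr add0r big1 ?mulr0 ?/x_0 ?mxE // => j _.
  rewrite /zcoord !mkE /= ?(mulNr (x_m1 p)) cosN sinN; ring.
- rewrite /zcoord !mkE /= ?(mulNr (x_m1 p)) cosN sinN [RHS]mxE; ring.
- rewrite /zcoord !mkE /= ?(mulNr (x_m1 p)) cosN sinN [RHS]mxE; ring.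
Qed.

End Oscillator.

(* Main.v *)
Require Import Defs.
From mathcomp Require Import all_boot all_order all_algebra.
From mathcomp Require Import all_classical all_reals all_analysis.
From mathcomp Require Import ring lra.
Set Implicit Arguments.
Unset Strict Implicit.
Unset Printing Implicit Defensive.
Import Order.TTheory GRing.Theory Num.Theory.
Import numFieldNormedType.Exports.
Local Open Scope classical_set_scope.
Local Open Scope ring_scope.

(** Put [w = u v], where [v] is the velocity of a curve moved to the identity.
    The geodesic equation becomes the Euler equation [w' = [w, u^-1 w]], whose
    right-hand side is quadratic, and the curve is recovered from [v] by
    quadratures; so everything reduces to an a priori bound for [w].

    The coordinate [p = w_{-1}] is constant.  Let [f = u^-1 e_0].  If [u]
    preserves the center, [f] is central; if [u] preserves a Cartan subalgebra
    [h], then [f] lies in [h], which is spanned by [e_0] and a vector outside the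
    Heisenberg ideal.  In both cases there is [X] with [X_{-1} = 1] such that [f]
    is a combination of [X] and [e_0].  The complex part [y] of [w - p X] then
    satisfies [y' = p J (P y) - v_{-1} J y], where [J] is a rotation in each
    complex plane and [P y] depends linearly on [(p, y)] only; the second term
    does not contribute to [(|y|^2)'], so [p^2 + |y|^2] grows at most
    exponentially.  Given a bound for [y], the equation for [w_0] is linear with
    bounded coefficients. *)

(** The energy [kform lam (u v) v] is conserved but indefinite, so it bounds nothing; a finer
    splitting is needed. The danger comes from [w_0]: it enters [v] through [w_0 f], and if it acted
    freely on the complex part, which in turn drives [w_0], finite-time blow-up could occur.
    Subtracting [p X] hides the complex part of [f]: [w_0] then reaches [y] only through the scalar
    [v_{-1}], which multiplies a skew operator. In the equation for [w_0], no square of [w_0]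
    appears because [e_0] is central, so the first argument of the bracket counts only modulo [e_0].
    Centrality also explains why [p] is constant: [p = kform lam w e_0], and brackets are orthogonal
    to the center.

    Global existence avoids maximal solutions: the field is cut off outside a ball, the truncated
    equation is solved on the whole line by Picard iteration, and the a priori bound shows that on a
    prescribed time window the truncation is never felt. Completeness is phrased as extension of a
    given geodesic, so uniqueness is needed too, and the passage to the Euler equation is an
    equivalence. *)

Section RowVectors.
Context {R : realType} {m : nat}.
Implicit Types x y : 'rV[R]_m.

Lemma ler_coord_norm x i : `|x 0 i| <= `|x|.
Proof.
rewrite [leRHS]/Num.Def.normr/= mx_normrE.
exact: (le_bigmax _ (fun i => `|x i.1 i.2|) (0, i)).
Qed.

Lemma rV_norm_le x C : 0 <= C -> (forall i, `|x 0 i| <= C) -> `|x| <= C.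
Proof.
move=> C0 h; rewrite [leLHS]/Num.Def.normr/= mx_normrE.
by apply: bigmax_le => // -[i j] _ /=; rewrite ord1.
Qed.

(** The norm on row vectors is the sup norm, which is not differentiable. Energy estimates are
    therefore run on sums of squares and brought back to the norm by this inequality. *)
Lemma sqr_norm_le_sum x : `|x| ^+ 2 <= \sum_i x 0 i ^+ 2.
Proof.
have h : 0 <= \sum_i x 0 i ^+ 2 by apply: sumr_ge0 => i _; exact: sqr_ge0.
rewrite -[leRHS]sqr_sqrtr// ler_sqr ?nnegrE ?sqrtr_ge0//.
apply: rV_norm_le; first exact: sqrtr_ge0.
move=> i; rewrite -sqrtr_sqr ler_wsqrtr// (bigD1 i)//= lerDl.
by apply: sumr_ge0 => j _; exact: sqr_ge0.
Qed.

Lemma is_derive_rowP {V : normedModType R} (M : V -> 'rV[R]_m) dM t v :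
  is_derive t v M dM <->
  forall i, is_derive t v (fun w => M w 0 i) (dM 0 i).
Proof.
split=> [[dv dE] i|h].
  split; first by move/derivable_mxP : dv; exact.
  by rewrite -dE derive_mx// mxE.
have dv : derivable M t v.
  by apply/derivable_mxP => i j; rewrite ord1; have [] := h j.
split=> //; rewrite derive_mx//; apply/rowP => j; rewrite mxE.
by have [_ ->] := h j.
Qed.

End RowVectors.

(** * Mean value estimates: Grönwall, weighted bounds, gluing of local solutions *)

Section MeanValue.
Context {R : realType}.
Implicit Types (f g df : R -> R) (J : set R) (a b s t : R).

Lemma is_derive_within_continuous f df a b :
  (forall x : R, a <= x <= b -> is_derive x 1 f (df x)) ->
  {within `[a, b], continuous f}.
Proof.
move=> h; apply: derivable_within_continuous => x; rewrite in_itv/= => /h.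
by case.
Qed.

Lemma ge0_is_derive_le f df a b : a <= b ->
  (forall x : R, a <= x <= b -> is_derive x 1 f (df x)) ->
  (forall x : R, a <= x <= b -> 0 <= df x) -> f a <= f b.
Proof.
move=> ab h df0.
have [||c] := MVT_segment ab (df := df) (f := f).
- by move=> x; rewrite in_itv/= => /andP[ax xb]; apply: h; rewrite !ltW.
- exact: is_derive_within_continuous h.
by rewrite in_itv/= => /df0 dc e; rewrite -subr_ge0 e mulr_ge0// subr_ge0.
Qed.

(** [f * expR (- K * x)] is nonincreasing and [f * expR (K * x)] is nondecreasing. Bounding [|df|]
    rather than [df] is what makes the estimate valid backward as well as forward in time. *)
Lemma gronwall f df J K : is_interval J ->
  (forall t, J t -> is_derive t 1 f (df t)) ->
  (forall t, J t -> `|df t| <= K * f t) ->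
  forall s t, J s -> J t -> f t <= f s * expR (K * `|t - s|).
Proof.
move=> iJ h hK s t Js Jt.
have dexp (k x : R) : is_derive x 1 (fun x => expR (k * x)) (k * expR (k * x)).
  have -> : (fun x => expR (k * x)) = expR \o (k \*: id).
    by apply/funext.
  by apply: is_derive_eq; rewrite /= mulrC /GRing.scale/= mulr1 mulrC.
have dg (k x : R) : J x -> is_derive x 1 (fun x => f x * expR (k * x))
    ((df x + k * f x) * expR (k * x)).
  move=> Jx; have ? := h _ Jx.
  apply: (is_derive_eq (f' := f x *: (k * expR (k * x)) + expR (k * x) *: df x)).
    exact: is_deriveM.
  by rewrite /GRing.scale/=; ring.
have [st|ts] := leP s t.
- have Jx x : s <= x <= t -> J x by move=> /andP[? ?]; apply: (iJ s t) => //; apply/andP.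
  have : - (f s * expR (- K * s)) <= - (f t * expR (- K * t)).
    apply: (@ge0_is_derive_le (fun x => - (f x * expR ((- K) * x)))
      (fun x => - ((df x + - K * f x) * expR (- K * x))) s t st).
  + by move=> x /Jx Jx'; apply: is_deriveN; exact: dg.
  + move=> x /Jx Jx'; rewrite -mulNr mulr_ge0 ?expR_ge0//.
    have := hK _ Jx'; rewrite ler_norml => /andP[_]; lra.
  rewrite lerN2 ger0_norm ?subr_ge0// => e.
  rewrite mulrBr expRB.
  have -> : expR (K * t) / expR (K * s) = expR (- K * s) / expR (- K * t).
    by rewrite !mulNr !expRN invrK mulrC.
  by rewrite mulrA ler_pdivlMr ?expR_gt0.
- have Jx x : t <= x <= s -> J x by move=> /andP[? ?]; apply: (iJ t s) => //; apply/andP.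
  have : f t * expR (K * t) <= f s * expR (K * s).
    apply: (@ge0_is_derive_le (fun x => (f x * expR (K * x)))
      (fun x => ((df x + K * f x) * expR (K * x))) t s (ltW ts)).
  + by move=> x /Jx Jx'; exact: dg.
  + move=> x /Jx Jx'; rewrite mulr_ge0 ?expR_ge0//.
    have := hK _ Jx'; rewrite ler_norml => /andP[+ _]; lra.
  rewrite ltr0_norm ?subr_lt0// opprB => e.
  by rewrite mulrBr expRB mulrA ler_pdivlMr ?expR_gt0.
Qed.

(** This is Grönwall with constant 0, applied to the square of the difference. *)
Lemma eq_is_derive_eq f g df J : is_interval J ->
  (forall t, J t -> is_derive t 1 f (df t)) ->
  (forall t, J t -> is_derive t 1 g (df t)) ->
  forall s t, J s -> J t -> f s = g s -> f t = g t.
Proof.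
move=> iJ hf hg s t Js Jt e.
have : (f t - g t) ^+ 2 <= (f s - g s) ^+ 2 * expR (0 * `|t - s|).
  apply: (@gronwall (fun x => (f x - g x) ^+ 2) (fun=> 0) J 0 iJ) => //.
- move=> x Jx; have ? := hf _ Jx; have ? := hg _ Jx.
  have -> : (fun x => (f x - g x) ^+ 2) = (f - g) ^+ 2.
    by apply/funext => z; rewrite !fctE.
  by apply: is_derive_eq; rewrite subrr scaler0.
- by move=> x _; rewrite normr0 mul0r.
rewrite e subrr expr0n mul0r => hle.
by apply/eqP; rewrite -subr_eq0 -sqrf_eq0 eq_le hle sqr_ge0.
Qed.

(* Differential form of the weighted-norm trick for Picard iterations: the
   weight [expR (2 L |t - t0|)] turns the integral operator into a contraction
   of ratio 1/2. *)
Lemma expR_weighted_bound f df (t0 L C : R) : 0 < L -> 0 <= C ->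
  (forall t, is_derive t 1 f (df t)) -> f t0 = 0 ->
  (forall t, `|df t| <= L * (C * expR (2 * L * `|t - t0|))) ->
  forall t, `|f t| <= C / 2 * expR (2 * L * `|t - t0|).
Proof.
move=> L0 C0 h f0 hb.
have pos g dg s : (forall t, is_derive t 1 g (dg t)) -> g s = 0 ->
    (forall t, s <= t -> dg t <= L * (C * expR (2 * L * (t - s)))) ->
    forall t, s <= t -> g t <= C / 2 * expR (2 * L * (t - s)).
  move=> hg g0 hdg t st.
  (* [w] is a primitive of the bound on [dg], so [w - g] is nondecreasing, and it starts from
     [C / 2 >= 0]. The factor 2 in the exponent is what produces the halved constant. *)
  pose w x := C / 2 * expR (2 * L * (x - s)).
  have dw (x : R) : is_derive x 1 w (L * (C * expR (2 * L * (x - s)))).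
    have -> : w = (C / 2) \*: (expR \o ((2 * L) \*: (id - cst s))) by apply/funext.
    apply: is_derive_eq; rewrite /= subr0 /GRing.scale/= mulr1.
    by field.
  have : (w - g) s <= (w - g) t.
    apply: (@ge0_is_derive_le (w - g)
      (fun x => L * (C * expR (2 * L * (x - s))) - dg x) s t st).
    by move=> x /andP[sx _]; rewrite subr_ge0 hdg.
  rewrite !fctE g0 subr0 /w subrr mulr0 expR0 mulr1 => e.
  have : 0 <= C / 2 by rewrite divr_ge0.
  lra.
move=> t; have [st|ts] := leP t0 t.
- rewrite (@ger0_norm _ (t - t0)) ?subr_ge0// ler_norml; apply/andP; split.
    rewrite lerNl; apply: (pos (- f) (- df)) => //.
    + by rewrite !fctE f0 oppr0.
    + move=> x tx; have := hb x; rewrite (@ger0_norm _ (x - t0)) ?subr_ge0// ler_norml !fctE => /andP[]; lra.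
  apply: (pos f df) => // x tx.
  by have := hb x; rewrite (@ger0_norm _ (x - t0)) ?subr_ge0// ler_norml => /andP[].
- rewrite (@ltr0_norm _ (t - t0)) ?subr_lt0// opprB.
  (* Times before [t0] are reduced to times after [t0] by the reflection [x -> 2 * t0 - x]. *)
  have dr (x : R) : is_derive x 1 (fun x => 2 * t0 - x) (-1).
    have -> : (fun x => 2 * t0 - x) = cst (2 * t0) - id by apply/funext.
    by apply: is_derive_eq; rewrite sub0r.
  have hr (x : R) : is_derive x 1 (f \o (fun x => 2 * t0 - x)) (- df (2 * t0 - x)).
    have ? := dr x; have ? := h (2 * t0 - x).
    by apply: is_derive_eq; rewrite mulrN1.
  have hb' x : t0 <= x -> `|df (2 * t0 - x)| <= L * (C * expR (2 * L * (x - t0))).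
    move=> tx; have := hb (2 * t0 - x).
    rewrite (_ : _ - t0 = - (x - t0)); last by lra.
    by rewrite (normrN (x - t0)) (@ger0_norm _ (x - t0)) ?subr_ge0.
  have -> : t = 2 * t0 - (2 * t0 - t) by lra.
  have -> : t0 - (2 * t0 - (2 * t0 - t)) = (2 * t0 - t) - t0 by lra.
  have tt : t0 <= 2 * t0 - t by lra.
  rewrite ler_norml; apply/andP; split.
    rewrite lerNl.
    apply: (pos (- (f \o (fun x => 2 * t0 - x))) (fun x => df (2 * t0 - x))) => //.
    + by move=> x; apply: is_derive_eq; rewrite opprK.
    + by rewrite !fctE (_ : 2 * t0 - t0 = t0) ?f0 ?oppr0//; lra.
    + by move=> x /hb'; rewrite ler_norml => /andP[].
  apply: (pos (f \o (fun x => 2 * t0 - x)) (fun x => - df (2 * t0 - x))) => //.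
  + by rewrite /= (_ : 2 * t0 - t0 = t0) ?f0 ?oppr0//; lra.
  + by move=> x /hb'; rewrite ler_norml => /andP[]; lra.
Qed.

(** The radius used at time [t] exceeds [|t - t0|] by 1, so it remains admissible for all times
    within distance 1 of [t]. There the glued curve coincides with a single [G r], whose derivative
    is known. *)
Lemma glue_is_derive {V : normedModType R} (G : R -> R -> V) (D : R -> V -> V) t0 :
  (forall r t, `|t - t0| < r -> is_derive t 1 (G r) (D t (G r t))) ->
  (forall r r' t, `|t - t0| < r -> `|t - t0| < r' -> G r t = G r' t) ->
  let x t := G (`|t - t0| + 1) t in forall t : R, is_derive t 1 x (D t (x t)).
Proof.
move=> h e x t; set r := `|t - t0| + 1.
have tr : `|t - t0| < r by rewrite ltrDl.
have := h _ _ tr; apply: near_eq_is_derive; near=> s.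
apply: e; last by rewrite ltrDl.
have : `|s - t| < 1 by near: s; apply/nbhs_normP; exists 1 => //= y; rewrite /ball_ /= distrC.
have := ler_normD (s - t) (t - t0); rewrite addrA subrK => h1 h2.
by apply: (le_lt_trans h1); rewrite [ltRHS]addrC ltrD2r.
Unshelve. all: by end_near. Qed.

End MeanValue.

(** * Geometric limits and primitives on the whole line *)

Section Primitives.
Context {R : realType}.

Lemma le_of_half_powers (a b c : R) : (forall k, a <= b + c / 2 ^+ k) -> a <= b.
Proof.
move=> h; have c1 : 0 < `|c| + 1 by rewrite ltr_wpDl.
apply/ler_addgt0Pr => e e0; have ce : 0 < (`|c| + 1) / e by rewrite divr_gt0.
have [k /ltW kce] : exists k, (`|c| + 1) / e < k%:R :> R.
  by exists (Num.truncn ((`|c| + 1) / e)).+1; rewrite truncnS_gt.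
apply: (le_trans (h k)); rewrite lerD2l ler_pdivrMr ?exprn_gt0//.
have k2 : k%:R <= 2 ^+ k :> R by rewrite -natrX ler_nat ltnW// ltn_expl.
have := le_trans kce k2; rewrite ler_pdivrMr// mulrC => h1.
have := ler_norm c; lra.
Qed.

(** With [d k] the sum of the geometric tail from [k] on, [a k - d k] increases and [a k + d k]
    decreases. The limit is the supremum of the lower sequence, squeezed below every term of the
    upper one. *)
Lemma lim_of_half_powers (a : nat -> R) (C : R) :
  (forall k, `|a k.+1 - a k| <= C / 2 ^+ k) ->
  exists l, forall k, `|l - a k| <= 2 * C / 2 ^+ k.
Proof.
move=> h; pose d k := 2 * C / 2 ^+ k.
have dS k : d k = d k.+1 + C / 2 ^+ k.
  by rewrite /d exprS; field; rewrite expf_neq0.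
have C0 : 0 <= C by have := le_trans (normr_ge0 _) (h 0%N); rewrite expr0 divr1.
have d0 k : 0 <= d k by rewrite /d divr_ge0 ?exprn_ge0 ?mulr_ge0.
have hu : {homo (fun k => a k - d k) : i j / (i <= j)%N >-> i <= j}.
  apply: homo_leq => [x//|y x z|k]; first exact: le_trans.
  by have := h k; rewrite (dS k) ler_norml => /andP[]; lra.
have hv : {homo (fun k => a k + d k) : i j / (i <= j)%N >-> j <= i}.
  apply: homo_leq => [x//|y x z h1 h2|k]; first exact: (le_trans h2).
  by have := h k; rewrite (dS k) ler_norml => /andP[]; lra.
have uv j k : a j - d j <= a k + d k.
  apply: (le_trans (hu _ _ (leq_maxl j k))).
  apply: le_trans (hv _ _ (leq_maxr j k)).
  by have := d0 (maxn j k); lra.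
exists (sup (range (fun k => a k - d k))) => k.
rewrite ler_distl; apply/andP; split.
- by apply: sup_upper_bound; [split; [exists (a 0%N - d 0%N); exists 0%N|
    exists (a 0%N + d 0%N) => _ [j _ <-]]|exists k].
- by apply: ge_sup; [exists (a 0%N - d 0%N); exists 0%N|move=> _ [j _ <-]].
Qed.

Lemma bounded_derive_lipschitz (f df : R -> R) B :
  (forall t : R, is_derive t 1 f (df t)) -> (forall t, `|df t| <= B) ->
  forall s t, `|f t - f s| <= B * `|t - s|.
Proof.
move=> h hB s t; wlog st : s t / s <= t.
  move=> hw; have [/hw//|/ltW/hw] := leP s t.
  by rewrite distrC (distrC s t).
have [|c _ ->] := MVT_segment st (df := df) (f := f).
  exact: is_derive_within_continuous (fun x _ => h x).
by rewrite normrM ler_wpM2r.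
Qed.

Lemma lipschitz_continuous (f : R -> R) K :
  (forall s t, `|f t - f s| <= K * `|t - s|) -> continuous f.
Proof.
move=> h s; apply/cvgrPdist_le => /= e e0; near=> t.
rewrite distrC (le_trans (h s t))//.
have K0 : 0 < `|K| + 1 by rewrite ltr_wpDl.
have : `|t - s| <= e / (`|K| + 1).
  near: t; apply/nbhs_normP; exists (e / (`|K| + 1)); first exact: divr_gt0.
  by move=> y; rewrite /ball_/= distrC => /ltW.
rewrite ler_pdivlMr// => he; apply: le_trans he.
rewrite mulrC ler_wpM2l//; have := ler_norm K; lra.
Unshelve. all: by end_near. Qed.

Lemma derivable_continuous (f : R -> R) :
  (forall t, derivable f t 1) -> continuous f.
Proof. by move=> h t; apply/differentiable_continuous/derivable1_diffP. Qed.

(** An integral needs a fixed left end, so a primitive is built on each window of radius [r] around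
    [t0] and normalised to take the value [a] at [t0]. This makes the windows agree, and they are
    glued. *)
Lemma continuous_has_primitive (f : R -> R) (t0 a : R) : continuous f ->
  exists P : R -> R, P t0 = a /\ forall t : R, is_derive t 1 P (f t).
Proof.
move=> cf.
pose H r x := \int[lebesgue_measure]_(t in `[t0 - r, x]) f t.
pose G r x := H r x - H r t0 + a.
have dG (r t : R) : `|t - t0| < r -> is_derive t 1 (G r) (f t).
  rewrite ltr_distl => /andP[rt tr].
  have [|dH HE] := @continuous_FTC1_closed R f (t0 - r) t (t0 + r) tr _ rt (cf t).
    apply: continuous_compact_integrable; first exact: segment_compact.
    exact: continuous_subspaceT.
  have ? : is_derive t 1 (H r) (f t) by split => //; rewrite -derive1E.
  have -> : G r = H r + cst (a - H r t0).
    apply/funext => x; rewrite /G !fctE; ring.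
  by apply: is_derive_eq; rewrite addr0.
have eG r r' t : `|t - t0| < r -> `|t - t0| < r' -> G r t = G r' t.
  move=> tr tr'; apply: (@eq_is_derive_eq R (G r) (G r') f
     [set s | `|s - t0| < r /\ `|s - t0| < r'] _ _ _ t0 t) => //=.
  - move=> x y /= [xr xr'] [yr yr'] z /andP[xz zy]; move: xr xr' yr yr'.
    by rewrite !ltr_distl => /andP[? ?] /andP[? ?] /andP[? ?] /andP[? ?]; split; apply/andP; split; lra.
  - by move=> x [xr _]; exact: dG.
  - by move=> x [_ xr]; exact: dG.
  - by rewrite subrr normr0; split; exact: le_lt_trans (normr_ge0 (t - t0)) _.
  - by rewrite /G !subrr.
exists (fun t => G (`|t - t0| + 1) t); split; first by rewrite /G subrr add0r.
exact: (glue_is_derive (D := fun t _ => f t)).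
Qed.

Lemma continuous_has_primitive_rV m (f : R -> 'rV[R]_m) (t0 : R) (a : 'rV[R]_m) :
  (forall i, continuous (fun t => f t 0 i)) ->
  exists P : R -> 'rV[R]_m, P t0 = a /\ forall t : R, is_derive t 1 P (f t).
Proof.
move=> cf.
have /choice[P hP] i := continuous_has_primitive t0 (a 0 i) (cf i).
exists (fun t => \row_i P i t); split.
  by apply/rowP => i; rewrite mxE (hP i).1.
move=> t; apply/is_derive_rowP => i.
have -> : (fun w : R => (\row_j P j w) 0 i) = P i by apply/funext => w; rewrite mxE.
exact: (hP i).2.
Qed.

End Primitives.

(** * Picard iteration for bounded, globally Lipschitz fields *)

Section ODE.
Context {R : realType} {m : nat}.
Implicit Types (F : 'rV[R]_m -> 'rV[R]_m) (x : R -> 'rV[R]_m).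

Lemma bounded_derive_lipschitz_rV x dx B : 0 <= B ->
  (forall t : R, is_derive t 1 x (dx t)) -> (forall t, `|dx t| <= B) ->
  forall s t, `|x t - x s| <= B * `|t - s|.
Proof.
move=> B0 h hB s t; apply: rV_norm_le; first exact: mulr_ge0.
move=> i; rewrite !mxE; apply: (@bounded_derive_lipschitz R (fun t => x t 0 i) (fun t => dx t 0 i) B _ _ s t).
  by move=> r; have /is_derive_rowP := h r.
by move=> r; exact: le_trans (ler_coord_norm _ _) (hB r).
Qed.

Lemma expR_weighted_bound_rV x dx (t0 L C : R) : 0 < L -> 0 <= C ->
  (forall t : R, is_derive t 1 x (dx t)) -> x t0 = 0 ->
  (forall t, `|dx t| <= L * (C * expR (2 * L * `|t - t0|))) ->
  forall t, `|x t| <= C / 2 * expR (2 * L * `|t - t0|).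
Proof.
move=> L0 C0 h x0 hb t; apply: rV_norm_le.
  by rewrite mulr_ge0 ?expR_ge0 ?divr_ge0.
move=> i; apply: (@expR_weighted_bound R (fun t => x t 0 i) (fun t => dx t 0 i) t0 L C L0 C0 _ _ _ t).
- by move=> r; have /is_derive_rowP := h r.
- by rewrite x0 mxE.
by move=> r; exact: le_trans (ler_coord_norm _ _) (hb r).
Qed.

Lemma picard_global F (x0 : 'rV[R]_m) (t0 B L : R) : 0 < L ->
  (forall p, `|F p| <= B) -> (forall p q, `|F p - F q| <= L * `|p - q|) ->
  exists x, x t0 = x0 /\ forall t : R, is_derive t 1 x (F (x t)).
Proof.
move=> L0 FB FL.
have B0 : 0 <= B := le_trans (normr_ge0 _) (FB 0).
pose lip x := forall s t, `|x t - x s| <= B * `|t - s|.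
(* [choice] needs a total operator. [T] is specified only on [B]-Lipschitz curves, along which
   [F \o x] is continuous and has a primitive; the boundedness of [F] keeps [T x] in this class. *)
have ex_prim x : exists y, lip x ->
    y t0 = x0 /\ forall t : R, is_derive t 1 y (F (x t)).
  have [lx|] := pselect (lip x); last by exists x.
  have [|y hy] := @continuous_has_primitive_rV R m (F \o x) t0 x0.
    move=> i; apply: (@lipschitz_continuous R _ (L * B)) => s t.
    have := ler_coord_norm (F (x t) - F (x s)) i; rewrite !mxE => h.
    by apply: (le_trans h); apply: (le_trans (FL _ _)); rewrite -mulrA ler_wpM2l// ltW.
  by exists y.
have [T hT] := choice ex_prim.
have lipT x : lip x -> lip (T x).
  move=> /hT[_ hx]; exact: (bounded_derive_lipschitz_rV B0 hx).
pose X k := iter k T (fun=> x0).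
have lipX k : lip (X k).
  elim: k => [|k ih] /=; last exact: lipT.
  by move=> s t; rewrite subrr normr0 mulr_ge0.
pose W t := expR (2 * L * `|t - t0|).
have W1 t : 1 <= W t by rewrite -expR0 ler_expR mulr_ge0 ?mulr_ge0// ltW.
have contr x y D : 0 <= D -> lip x -> lip y ->
    (forall t, `|x t - y t| <= D * W t) ->
    forall t, `|T x t - T y t| <= D / 2 * W t.
  move=> D0 lx ly hxy.
  have [x1 dx] := hT _ lx; have [y1 dy] := hT _ ly.
  apply: (@expR_weighted_bound_rV (T x - T y) (fun t => F (x t) - F (y t))) => //.
    by rewrite !fctE x1 y1 subrr.
  by move=> t; rewrite (le_trans (FL _ _))// ler_wpM2l// ltW.
(* The first iterate moves with speed at most [B = L * C], which is the form required by the
   weighted bound. *)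
pose C := B / L.
have C0 : 0 <= C by rewrite divr_ge0// ltW.
have XS k t : `|X k.+1 t - X k t| <= (C * W t) / 2 ^+ k.
  have -> : (C * W t) / 2 ^+ k = (C / 2 ^+ k) * W t by ring.
  elim: k t => [|k ih] t.
    have [x1 dx] := hT _ (lipX 0%N).
    have h : `|X 1%N t - X 0%N t| <= C / 2 * W t.
      apply: (@expR_weighted_bound_rV (X 1%N - X 0%N) (fun t => F x0)) => //.
      - by move=> r; have := is_deriveB (dx r) (is_derive_cst x0 r 1); rewrite subr0.
      - by apply/eqP; rewrite !fctE subr_eq0; apply/eqP.
      - move=> r; apply: (le_trans (FB _)).
        rewrite mulrA /C mulrCA divff ?gt_eqF// mulr1 ler_peMr//; exact: W1.
    apply: (le_trans h); rewrite ler_wpM2r ?expR_ge0// expr0; lra.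
  have := contr (X k.+1) (X k) (C / 2 ^+ k) _ (lipX _) (lipX _) ih t.
  by rewrite exprSr invfM mulrA; apply; rewrite divr_ge0// exprn_ge0.
have /choice[Y hY] t : exists l, forall k, `|l - X k t| <= (2 * (C * W t)) / 2 ^+ k.
  have /choice[l hl] i : exists l, forall k, `|l - X k t 0 i| <= 2 * (C * W t) / 2 ^+ k.
    apply: lim_of_half_powers => k; have := ler_coord_norm (X k.+1 t - X k t) i.
    by rewrite !mxE => /le_trans; apply.
  exists (\row_i l i) => k; apply: rV_norm_le => [|i]; last by rewrite !mxE.
  by rewrite divr_ge0 ?exprn_ge0// mulr_ge0// mulr_ge0// expR_ge0.
(* The limit has to be [B]-Lipschitz itself, since otherwise nothing is known of [T Y]. *)
have lipY : lip Y.
  move=> s t; apply: (@le_of_half_powers _ _ _ (2 * (C * W t) + 2 * (C * W s))) => k.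
  have h1 := hY t k; have h2 := hY s k; have h3 := lipX k s t.
  have -> : Y t - Y s = (Y t - X k t) + (X k t - X k s) - (Y s - X k s).
    by rewrite opprB !addrA !subrK.
  apply: (le_trans (ler_normB _ _)).
  have := ler_normD (Y t - X k t) (X k t - X k s); rewrite mulrDl; lra.
have [y1 dy] := hT _ lipY.
(* Both sides are within a multiple of [1 / 2 ^ k] of [X k.+1]: [T Y] by contraction, [Y] by its
   definition as the limit. *)
have YE : T Y = Y.
  apply/funext => t; apply/eqP; rewrite -subr_eq0 -normr_le0.
  apply: (@le_of_half_powers _ _ _ (2 * C * W t)) => k; rewrite add0r.
  have h1 := hY t k.+1.
  have h2 : `|T Y t - X k.+1 t| <= (2 * C / 2 ^+ k) / 2 * W t.
    apply: contr => //; first by rewrite divr_ge0 ?exprn_ge0// mulr_ge0.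
    by move=> r; apply: (le_trans (hY r k)); rewrite le_eqVlt; apply/orP; left; apply/eqP; ring.
  have -> : T Y t - Y t = (T Y t - X k.+1 t) - (Y t - X k.+1 t).
    by rewrite opprB addrA subrK.
  apply: (le_trans (ler_normB _ _)); apply: (le_trans (lerD h2 h1)).
  by rewrite le_eqVlt; apply/orP; left; apply/eqP; rewrite exprS; field; rewrite expf_neq0.
by exists Y; split => [|t]; [rewrite -YE|have := dy t; rewrite YE].
Qed.

End ODE.

Section PointwiseDerivatives.
Context {R : realType} {V : normedModType R}.
Implicit Types (f g : V -> R) (p v : V).

Lemma is_derive_ptwD f g p v df dg : is_derive p v f df -> is_derive p v g dg ->
  is_derive p v (fun q => f q + g q) (df + dg).
Proof. exact: is_deriveD. Qed.

Lemma is_derive_ptwB f g p v df dg : is_derive p v f df -> is_derive p v g dg ->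
  is_derive p v (fun q => f q - g q) (df - dg).
Proof. exact: is_deriveB. Qed.

Lemma is_derive_ptwM f g p v df dg : is_derive p v f df -> is_derive p v g dg ->
  is_derive p v (fun q => f q * g q) (df * g p + f p * dg).
Proof.
move=> hf hg; have := is_deriveM hf hg.
by rewrite /GRing.scale/= addrC [g p * _]mulrC.
Qed.

Lemma is_derive_ptw_sum n (h : 'I_n -> V -> R) dh p v :
  (forall i, is_derive p v (h i) (dh i)) ->
  is_derive p v (fun q => \sum_i h i q) (\sum_i dh i).
Proof.
move=> hh; have := is_derive_sum hh.
by congr (is_derive _ _ _ _); apply/funext => q; rewrite fct_sumE.
Qed.

End PointwiseDerivatives.

Section Cutoff.
Context {R : realType}.

Definition clamp01 (a : R) : R := Num.max 0 (Num.min 1 a).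

Lemma clamp01_bounds a : 0 <= clamp01 a <= 1.
Proof. by rewrite /clamp01 le_max lexx ge_max ler01 ge_min lexx. Qed.

Lemma clamp01_eq1 a : 1 <= a -> clamp01 a = 1.
Proof. by move=> a1; rewrite /clamp01 (min_idPl a1); apply/max_idPr. Qed.

Lemma clamp01_eq0 a : a <= 0 -> clamp01 a = 0.
Proof.
move=> a0; rewrite /clamp01; apply/max_idPl.
by rewrite ge_min a0 orbT.
Qed.

Lemma clamp01_lipschitz a b : `|clamp01 a - clamp01 b| <= `|a - b|.
Proof.
wlog ab : a b / b <= a.
  move=> h; have [/h//|/ltW/h] := leP b a.
  by rewrite distrC (distrC b).
have [a0|a0] := leP a 0.
  by rewrite (clamp01_eq0 a0) clamp01_eq0 ?subrr ?normr0// (le_trans ab).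
have [b1|b1] := leP 1 b.
  by rewrite (clamp01_eq1 b1) clamp01_eq1 ?subrr ?normr0// (le_trans _ ab).
have ca : clamp01 a <= a.
  by rewrite /clamp01 ge_max (ltW a0) ge_min lexx orbT.
have cb : b <= clamp01 b.
  by rewrite /clamp01 (min_idPr (ltW b1)) le_max lexx orbT.
have cab : clamp01 b <= clamp01 a.
  by rewrite /clamp01 ge_max !le_max lexx/= le_min !ge_min lexx ab orbT/= orbT.
by rewrite !ger0_norm ?subr_ge0//; lra.
Qed.

End Cutoff.

(** * Uniqueness and global existence for locally Lipschitz fields *)

Section GlobalODE.
Context {R : realType} {m : nat}.
Implicit Types (F : 'rV[R]_m -> 'rV[R]_m) (x y : R -> 'rV[R]_m) (p q : 'rV[R]_m).

Definition locally_lipschitz F := forall rho, exists2 L, 0 < L &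
  forall p q, `|p| <= rho -> `|q| <= rho -> `|F p - F q| <= L * `|p - q|.

Lemma derivable_bounded_segment x a b : a <= b ->
  (forall t : R, a <= t <= b -> derivable x t 1) ->
  exists C, forall t, a <= t <= b -> `|x t| <= C.
Proof.
move=> ab dx.
have [|c _ hc] := @EVT_max R (fun t => `|x t|) a b ab.
  apply/continuous_in_subspaceT => t; rewrite inE/= in_itv/= => tab.
  apply: continuous_comp; last exact: norm_continuous.
  exact/differentiable_continuous/derivable1_diffP/dx.
by exists `|x c| => t tab; apply: hc; rewrite in_itv.
Qed.

(** Both solutions are bounded on the compact segment between [s] and [t], so one Lipschitz constant
    serves there. Grönwall then applies to the Euclidean square of the difference, which vanishes at
    [s]. *)
Lemma ode_unique F x y J : locally_lipschitz F -> is_interval J ->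
  (forall t : R, J t -> is_derive t 1 x (F (x t))) ->
  (forall t : R, J t -> is_derive t 1 y (F (y t))) ->
  forall s t, J s -> J t -> x s = y s -> x t = y t.
Proof.
move=> lF iJ dx dy s t Js Jt e.
pose a := Num.min s t; pose b := Num.max s t.
have ab : a <= b by rewrite /a /b ge_min !le_max lexx.
have Jab r : a <= r <= b -> J r.
  rewrite /a /b ge_min le_max => /andP[/orP[sr|tr] /orP[rs|rt]].
  - by have -> : r = s by apply/le_anti/andP.
  - by apply: (iJ s t) => //; apply/andP.
  - by apply: (iJ t s) => //; apply/andP.
  - by have -> : r = t by apply/le_anti/andP.
have [Cx hx] : exists C, forall t, a <= t <= b -> `|x t| <= C.
  by apply: derivable_bounded_segment => // r /Jab/dx[].
have [Cy hy] : exists C, forall t, a <= t <= b -> `|y t| <= C.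
  by apply: derivable_bounded_segment => // r /Jab/dy[].
have [L L0 hL] := lF (Num.max Cx Cy).
pose f r := \sum_i (x r 0 i - y r 0 i) ^+ 2.
pose df r := \sum_(i < m) 2 * (x r 0 i - y r 0 i) * (F (x r) 0 i - F (y r) 0 i).
have : f t <= f s * expR (m%:R * (2 * L) * `|t - s|).
  apply: (@gronwall R f df [set r | a <= r <= b]) => /=.
  - by move=> r1 r2 /andP[h1 h2] /andP[h3 h4] r /andP[h5 h6]; apply/andP; split; lra.
  - move=> r /Jab Jr; apply: is_derive_ptw_sum => i.
    have /is_derive_rowP/(_ i) dxi := dx _ Jr.
    have /is_derive_rowP/(_ i) dyi := dy _ Jr.
    have h := is_derive_ptwB dxi dyi.
    by apply: is_derive_eq (is_derive_ptwM h h) _; ring.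
  - move=> r rab; apply: (le_trans (ler_norm_sum _ _ _)).
    have hd : `|x r - y r| ^+ 2 <= f r.
      apply: (le_trans (sqr_norm_le_sum _)); rewrite /f.
      by under eq_bigr do rewrite !mxE.
    have hF : `|F (x r) - F (y r)| <= L * `|x r - y r|.
      by apply: hL; rewrite le_max ?hx ?hy ?orbT.
    apply: (@le_trans _ _ (\sum_(i < m) 2 * L * f r)).
      apply: ler_sum => i _; rewrite !normrM normr_nat.
      have h1 : `|x r 0 i - y r 0 i| <= `|x r - y r|.
        by have := ler_coord_norm (x r - y r) i; rewrite !mxE.
      have h2 : `|F (x r) 0 i - F (y r) 0 i| <= L * `|x r - y r|.
        by apply: le_trans hF; have := ler_coord_norm (F (x r) - F (y r)) i; rewrite !mxE.
      rewrite -!mulrA ler_wpM2l//.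
      apply: (le_trans (ler_pM _ _ h1 h2)) => //.
      by rewrite mulrCA ler_wpM2l// ltW.
    by rewrite sumr_const card_ord -[leLHS]mulr_natl mulrA.
  - by rewrite /= /a /b ge_min le_max !lexx.
  - by rewrite /= /a /b ge_min le_max !lexx !orbT.
have -> : f s = 0 by rewrite /f big1// => i _; rewrite e subrr expr0n.
rewrite mul0r => ft0.
have : `|x t - y t| ^+ 2 <= 0.
  apply: le_trans ft0; apply: (le_trans (sqr_norm_le_sum _)); rewrite /f.
  by under eq_bigr do rewrite !mxE.
rewrite le_eqVlt ltNge sqr_ge0 orbF sqrf_eq0 normr_eq0 subr_eq0.
by move/eqP.
Qed.

Lemma cutoff_lipschitz F rho B L : 0 < rho -> 0 <= B -> 0 < L ->
  (forall p, `|p| <= 2 * rho -> `|F p| <= B) ->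
  (forall p q, `|p| <= 2 * rho -> `|q| <= 2 * rho -> `|F p - F q| <= L * `|p - q|) ->
  let phi p := clamp01 (2 - `|p| / rho) in
  forall p q, `|phi p *: F p - phi q *: F q| <= (L + B / rho) * `|p - q|.
Proof.
move=> rho0 B0 L0 FB FL phi.
have phi0 p : 2 * rho < `|p| -> phi p = 0.
  by move=> h; apply: clamp01_eq0; rewrite subr_le0 ler_pdivlMr// ltW.
have phiB p : 0 <= phi p <= 1 := clamp01_bounds _.
have phiL p q : `|phi p - phi q| <= `|p - q| / rho.
  apply: (le_trans (clamp01_lipschitz _ _)).
  rewrite (_ : _ - _ = (`|q| - `|p|) / rho); last by ring.
  rewrite normrM (gtr0_norm (_ : 0 < rho^-1)) ?invr_gt0//.
  by rewrite ler_wpM2r ?invr_ge0 ?(ltW rho0)// (distrC p) ler_dist_dist.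
(* One point in the ball is enough. If [q] lies outside, [phi q = 0] and only the term
   [(phi p - phi q) *: F p] survives, so no control of [F q] is required. *)
have key p q : `|p| <= 2 * rho ->
    `|phi p *: F p - phi q *: F q| <= (L + B / rho) * `|p - q|.
  move=> hp.
  have h1 : `|(phi p - phi q) *: F p| <= B / rho * `|p - q|.
    rewrite normrZ; apply: (le_trans (ler_pM _ _ (phiL p q) (FB _ hp))) => //.
    by rewrite le_eqVlt; apply/orP; left; apply/eqP; ring.
  have [hq|hq] := leP `|q| (2 * rho).
    have -> : phi p *: F p - phi q *: F q = phi q *: (F p - F q) + (phi p - phi q) *: F p.
      by rewrite scalerBr scalerBl [RHS]addrC addrA subrK.
    rewrite mulrDl; apply: (le_trans (ler_normD _ _)); apply: lerD => //.
    have /andP[q0 q1] := phiB q.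
    rewrite normrZ ger0_norm//; apply: le_trans (FL _ _ hp hq).
    by rewrite ler_piMl.
  rewrite (phi0 _ hq) scale0r subr0; move: h1; rewrite (phi0 _ hq) subr0 => h1.
  by apply: (le_trans h1); rewrite ler_wpM2r// lerDr ltW.
move=> p q; have [hp|hp] := leP `|p| (2 * rho); first exact: key.
have [hq|hq] := leP `|q| (2 * rho).
  by rewrite distrC (distrC p); exact: key.
rewrite (phi0 _ hp) (phi0 _ hq) !scale0r subrr normr0 mulr_ge0//.
by rewrite addr_ge0 ?divr_ge0// ltW.
Qed.

(* The a priori bound is required along all slowed-down solutions
   [x' = phi(t) F(x)], so that it applies to the solutions of the equation cut
   off outside a large ball. *)
Lemma ode_global F (t0 : R) p0 : locally_lipschitz F ->
  (forall T, exists C, forall x (phi : R -> R), (forall t, 0 <= phi t <= 1) ->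
     x t0 = p0 -> (forall t : R, is_derive t 1 x (phi t *: F (x t))) ->
     forall t, `|t - t0| <= T -> `|x t| <= C) ->
  exists x, x t0 = p0 /\ forall t : R, is_derive t 1 x (F (x t)).
Proof.
move=> lF apriori.
have /choice[G hG] r : exists x, x t0 = p0 /\
    forall t : R, `|t - t0| <= r -> is_derive t 1 x (F (x t)).
  have [C hC] := apriori r; pose rho := `|C| + 1.
  have rho0 : 0 < rho by rewrite ltr_wpDl.
  have [L L0 hL] := lF (2 * rho).
  have r20 : `|0 : 'rV[R]_m| <= 2 * rho by rewrite normr0 mulr_ge0// ltW.
  pose B := `|F 0| + L * (2 * rho).
  have FB p : `|p| <= 2 * rho -> `|F p| <= B.
    move=> hp; rewrite -(subrK (F 0) (F p)) addrC.
    apply: (le_trans (ler_normD _ _)); rewrite lerD2l.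
    apply: (le_trans (hL _ _ hp r20)); rewrite subr0 ler_wpM2l//; exact: ltW.
  have B0 : 0 <= B := le_trans (normr_ge0 _) (FB _ r20).
  have lipG := cutoff_lipschitz rho0 B0 L0 FB hL.
  pose phi p := clamp01 (2 - `|p| / rho).
  have [|p|//|x [x0 dx]] := @picard_global R m (fun p => phi p *: F p) p0 t0 B (L + B / rho).
  - by rewrite ltr_wpDr// divr_ge0// ltW.
  - have /andP[f0 f1] := clamp01_bounds (2 - `|p| / rho).
    rewrite normrZ ger0_norm//; have [hp|hp] := leP `|p| (2 * rho).
      by apply: le_trans (FB _ hp); rewrite ler_piMl.
    by rewrite /phi clamp01_eq0 ?mul0r// subr_le0 ler_pdivlMr// ltW.
  exists x; split => // t tr.
  (* A solution of the truncated equation is a solution slowed down by [phi \o x]. The a priori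
     bound keeps it where [|x| <= rho], and there the cutoff equals 1. *)
  have hx := hC x (phi \o x) (fun=> clamp01_bounds _) x0 dx _ tr.
  have := dx t; rewrite /phi clamp01_eq1 ?scale1r// lerBrDl -lerBrDr.
  rewrite ler_pdivrMr// (le_trans hx)// /rho; have := ler_norm C; lra.
have eG r r' t : `|t - t0| < r -> `|t - t0| < r' -> G r t = G r' t.
  move=> tr tr'; apply: (@ode_unique F _ _
     [set s | `|s - t0| < r /\ `|s - t0| < r'] lF _ _ _ t0 t) => //=.
  - move=> u w /= [xr xr'] [yr yr'] z /andP[xz zy]; move: xr xr' yr yr'.
    by rewrite !ltr_distl => /andP[? ?] /andP[? ?] /andP[? ?] /andP[? ?]; split; apply/andP; split; lra.
  - by move=> s [/ltW xr _]; apply: (hG r).2.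
  - by move=> s [_ /ltW xr]; apply: (hG r').2.
  - by rewrite subrr normr0; split; exact: le_lt_trans (normr_ge0 (t - t0)) _.
  - by rewrite (hG r).1 (hG r').1.
exists (fun t => G (`|t - t0| + 1) t); split; first exact: (hG _).1.
apply: (glue_is_derive (D := fun _ => F)) => // r t /ltW; exact: (hG r).2.
Qed.

End GlobalODE.

Lemma linear_sum_scale {R : nzRingType} {V W : lmodType R} (f : V -> W) m
    (k : 'I_m -> R) (x : 'I_m -> V) :
  linear f -> f (\sum_i k i *: x i) = \sum_i k i *: f (x i).
Proof.
move=> lf.
have fD a b : f (a + b) = f a + f b by have := lf 1 a b; rewrite !scale1r.
have f0 : f 0 = 0 by have := lf (-1) 0 0; rewrite scaleN1r oppr0 addr0 scaleN1r addNr.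
rewrite (big_morph f fD f0); apply: eq_bigr => i _.
by have := lf (k i) (x i) 0; rewrite !addr0 f0 addr0.
Qed.

Section BilinearBounds.
Context {R : realType} {m : nat} {W : normedModType R}.
Implicit Types (f : 'rV[R]_m -> W) (B : 'rV[R]_m -> 'rV[R]_m -> W).

Lemma linear_delta_expand (W' : lmodType R) (f : 'rV[R]_m -> W') : linear f ->
  forall p, f p = \sum_i p 0 i *: f (delta_mx 0 i).
Proof. by move=> lf p; rewrite {1}(row_sum_delta p) linear_sum_scale. Qed.

Lemma linear_bounded f : linear f -> exists2 K, 0 <= K & forall p, `|f p| <= K * `|p|.
Proof.
move=> lf; exists (\sum_i `|f (delta_mx 0 i)|); first exact: sumr_ge0.
move=> p; rewrite (linear_delta_expand lf) mulr_suml.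
apply: (le_trans (ler_norm_sum _ _ _)); apply: ler_sum => i _.
by rewrite normrZ mulrC ler_wpM2l// ler_coord_norm.
Qed.

Lemma bilinear_bounded B : (forall p, linear (B p)) -> (forall q, linear (B^~ q)) ->
  exists2 K, 0 <= K & forall p q, `|B p q| <= K * `|p| * `|q|.
Proof.
move=> lr ll.
have /choice[K hK] i : exists K, 0 <= K /\
    forall q, `|B (delta_mx 0 i) q| <= K * `|q|.
  by have [K K0 hK] := linear_bounded (lr (delta_mx 0 i)); exists K.
exists (\sum_i K i); first by apply: sumr_ge0 => i _; exact: (hK i).1.
move=> p q; rewrite (linear_delta_expand (ll q)) !mulr_suml.
apply: (le_trans (ler_norm_sum _ _ _)); apply: ler_sum => i _.
rewrite normrZ [K i * _]mulrC -mulrA.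
by apply: ler_pM => //; [exact: ler_coord_norm|exact: (hK i).2].
Qed.

End BilinearBounds.

Lemma bilinear_delta_expand {R : realType} m (B : 'rV[R]_m -> 'rV[R]_m -> R) :
  (forall x, linear (B x : _ -> R^o)) -> (forall y, linear ((B^~ y) : _ -> R^o)) ->
  forall x y, B x y = \sum_i \sum_j B (delta_mx 0 i) (delta_mx 0 j) * x 0 i * y 0 j.
Proof.
move=> lr ll x y.
rewrite (linear_delta_expand (ll y)); apply: eq_bigr => i _.
rewrite (linear_delta_expand (lr _)) scaler_sumr; apply: eq_bigr => j _.
by rewrite /GRing.scale/=; ring.
Qed.

(** [B p p - B q q = B (p - q) p + B q (p - q)], and each term is at most [K * |rho| * |p - q|]. The
    extra 1 only makes the constant positive. *)
Lemma quadratic_locally_lipschitz {R : realType} m (B : 'rV[R]_m -> 'rV[R]_m -> 'rV[R]_m) :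
  (forall p, linear (B p)) -> (forall q, linear (B^~ q)) ->
  locally_lipschitz (fun p => B p p).
Proof.
move=> lr ll rho; have [K K0 hK] := bilinear_bounded lr ll.
exists (2 * K * `|rho| + 1); first by rewrite ltr_wpDl// !mulr_ge0.
move=> p q hp hq.
have Bl a b c : B (a - b) c = B a c - B b c.
  by have := ll c (-1) b a; rewrite /= !scaleN1r [- b + a]addrC => ->; rewrite addrC.
have Br a b c : B a (b - c) = B a b - B a c.
  by have := lr a (-1) c b; rewrite /= !scaleN1r [- c + b]addrC => ->; rewrite addrC.
have -> : B p p - B q q = B (p - q) p + B q (p - q).
  by rewrite Bl Br addrA subrK.
apply: (le_trans (ler_normD _ _)).
have h1 := hK (p - q) p; have h2 := hK q (p - q).
have hr : rho <= `|rho| := ler_norm _.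
have e1 : K * `|p - q| * `|p| <= K * `|p - q| * `|rho|.
  by rewrite ler_wpM2l ?mulr_ge0// (le_trans hp).
have e2 : K * `|q| * `|p - q| <= K * `|p - q| * `|rho|.
  by rewrite -!mulrA ler_wpM2l// mulrC ler_wpM2l// (le_trans hq).
have := normr_ge0 (p - q); nra.
Qed.

Section DerivativeOnLine.
Context {R : realType} {V : normedModType R}.

(** Restricting to a line turns directional derivatives into derivatives in one variable, where the
    scalar chain rule applies. *)
Lemma is_derive_lineP {W : normedModType R} (f : V -> W) (p v : V) df :
  is_derive (0 : R) 1 (fun h : R => f (h *: v + p)) df <-> is_derive p v f df.
Proof.
have e : (fun h : R => h^-1 *: (((fun h : R => f (h *: v + p)) \o shift (0 : R)) (h *: 1) -
      f ((0 : R) *: v + p))) = (fun h => h^-1 *: ((f \o shift p) (h *: v) - f p)).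
  by apply/funext => h /=; rewrite scale0r add0r addr0 /GRing.scale/= mulr1.
by split; move=> [h1 h2]; split; move: h1 h2; rewrite /derivable /derive e.
Qed.

Lemma is_derive_comp_real (f : V -> R) (g : R -> R) p v df dg :
  is_derive p v f df -> is_derive (f p) 1 g dg ->
  is_derive p v (fun q => g (f q)) (dg * df).
Proof.
move=> /is_derive_lineP hf hg; apply/is_derive_lineP.
have hg' : is_derive (f ((0 : R) *: v + p)) 1 g dg by rewrite scale0r add0r.
have := @is_derive1_comp _ g (fun h : R => f (h *: v + p)) 0 dg df hg' hf.
exact.
Qed.

Lemma bilinear_is_derive {m : nat} (B : 'rV[R]_m -> 'rV[R]_m -> R) (f g : V -> 'rV[R]_m) p v df dg :
  (forall x, linear (B x : _ -> R^o)) -> (forall y, linear ((B^~ y) : _ -> R^o)) ->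
  is_derive p v f df -> is_derive p v g dg ->
  is_derive p v (fun q => B (f q) (g q)) (B df (g p) + B (f p) dg).
Proof.
move=> lr ll hf hg.
have BE := bilinear_delta_expand lr ll.
have -> : (fun q => B (f q) (g q)) = (fun q => \sum_i \sum_j
   B (delta_mx 0 i) (delta_mx 0 j) * f q 0 i * g q 0 j).
  by apply/funext => q; exact: BE.
rewrite 2!BE -big_split; apply: is_derive_ptw_sum => i.
rewrite -big_split; apply: is_derive_ptw_sum => j /=.
have /is_derive_rowP/(_ i) hfi := hf; have /is_derive_rowP/(_ j) hgj := hg.
have hc := is_derive_cst (B (delta_mx 0 i) (delta_mx 0 j)) p v.
apply: is_derive_eq (is_derive_ptwM (is_derive_ptwM hc hfi) hgj) _.
by rewrite /=; ring.
Qed.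

Lemma linear_is_derive {m k : nat} (L : 'rV[R]_m -> 'rV[R]_k) (f : V -> 'rV[R]_m) p v df :
  linear L -> is_derive p v f df -> is_derive p v (fun q => L (f q)) (L df).
Proof.
move=> lL hf; apply/is_derive_rowP => i.
have LE x : L x 0 i = \sum_j x 0 j * L (delta_mx 0 j) 0 i.
  by rewrite (linear_delta_expand lL) summxE; apply: eq_bigr => j _; rewrite mxE.
have -> : (fun q => L (f q) 0 i) = (fun q => \sum_j f q 0 j * L (delta_mx 0 j) 0 i).
  by apply/funext => q; exact: LE.
rewrite LE; apply: is_derive_ptw_sum => j.
have /is_derive_rowP/(_ j) hfj := hf.
have hc := is_derive_cst (L (delta_mx 0 j) 0 i) p v.
by apply: is_derive_eq (is_derive_ptwM hfj hc) _; rewrite /= mulr0 addr0.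
Qed.

End DerivativeOnLine.

(** * The invariant form and the Maurer-Cartan form in coordinates *)

Section OscillatorAlgebra.
Context {R : realType} {n : nat}.
Variable lam : 'I_n -> R.
Implicit Types (x y z p q xi eta v a : osc R n) (j : 'I_n).

Lemma x_m1D x y : x_m1 (x + y) = x_m1 x + x_m1 y. Proof. by rewrite /x_m1 mxE. Qed.
Lemma x_0D x y : x_0 (x + y) = x_0 x + x_0 y. Proof. by rewrite /x_0 mxE. Qed.
Lemma x_eD x y j : x_e (x + y) j = x_e x j + x_e y j. Proof. by rewrite /x_e mxE. Qed.
Lemma x_e'D x y j : x_e' (x + y) j = x_e' x j + x_e' y j. Proof. by rewrite /x_e' mxE. Qed.
Lemma x_m1N x : x_m1 (- x) = - x_m1 x. Proof. by rewrite /x_m1 mxE. Qed.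
Lemma x_0N x : x_0 (- x) = - x_0 x. Proof. by rewrite /x_0 mxE. Qed.
Lemma x_eN x j : x_e (- x) j = - x_e x j. Proof. by rewrite /x_e mxE. Qed.
Lemma x_e'N x j : x_e' (- x) j = - x_e' x j. Proof. by rewrite /x_e' mxE. Qed.
Lemma x_m1Z (k : R) x : x_m1 (k *: x) = k * x_m1 x. Proof. by rewrite /x_m1 mxE. Qed.
Lemma x_0Z (k : R) x : x_0 (k *: x) = k * x_0 x. Proof. by rewrite /x_0 mxE. Qed.
Lemma x_eZ (k : R) x j : x_e (k *: x) j = k * x_e x j. Proof. by rewrite /x_e mxE. Qed.
Lemma x_e'Z (k : R) x j : x_e' (k *: x) j = k * x_e' x j. Proof. by rewrite /x_e' mxE. Qed.
Lemma x_m1_zero : x_m1 (0 : osc R n) = 0. Proof. by rewrite /x_m1 mxE. Qed.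
Lemma x_0_zero : x_0 (0 : osc R n) = 0. Proof. by rewrite /x_0 mxE. Qed.
Lemma x_e_zero j : x_e (0 : osc R n) j = 0. Proof. by rewrite /x_e mxE. Qed.
Lemma x_e'_zero j : x_e' (0 : osc R n) j = 0. Proof. by rewrite /x_e' mxE. Qed.

Definition coordE := (x_m1D, x_0D, x_eD, x_e'D, x_m1N, x_0N, x_eN, x_e'N,
  x_m1Z, x_0Z, x_eZ, x_e'Z, x_m1_zero, x_0_zero, x_e_zero, x_e'_zero).

Lemma osc_indexP (P : 'I_(osc_dim n) -> Prop) :
  P (lshift (n + n) (lshift 1 ord0)) -> P (lshift (n + n) (rshift 1 ord0)) ->
  (forall j, P (rshift (1 + 1) (lshift n j))) ->
  (forall j, P (rshift (1 + 1) (rshift n j))) -> forall i, P i.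
Proof.
move=> h1 h2 h3 h4 i; case: (split_ordP i) => k ->; case: (split_ordP k) => l -> //.
  by rewrite (ord1 l).
by rewrite (ord1 l).
Qed.

Lemma is_derive_osc {V : normedModType R} (M : V -> osc R n) dM (t v : V) :
  is_derive t v (fun w => x_m1 (M w)) (x_m1 dM) ->
  is_derive t v (fun w => x_0 (M w)) (x_0 dM) ->
  (forall j, is_derive t v (fun w => x_e (M w) j) (x_e dM j)) ->
  (forall j, is_derive t v (fun w => x_e' (M w) j) (x_e' dM j)) ->
  is_derive t v M dM.
Proof. by move=> ? ? ? ?; apply/is_derive_rowP; apply: osc_indexP. Qed.

Lemma is_derive_coords {V : normedModType R} (M : V -> osc R n) dM (t v : V) :
  is_derive t v M dM ->
  [/\ is_derive t v (fun w => x_m1 (M w)) (x_m1 dM),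
   is_derive t v (fun w => x_0 (M w)) (x_0 dM),
   forall j, is_derive t v (fun w => x_e (M w) j) (x_e dM j) &
   forall j, is_derive t v (fun w => x_e' (M w) j) (x_e' dM j)].
Proof.
move=> /is_derive_rowP h.
by split=> [||j|j]; [exact: h (lshift (n + n) (lshift 1 ord0))|
  exact: h (lshift (n + n) (rshift 1 ord0))|
  exact: h (rshift (1 + 1) (lshift n j))|exact: h (rshift (1 + 1) (rshift n j))].
Qed.

Lemma kformC x y : kform lam x y = kform lam y x.
Proof.
rewrite /kform; congr (_ + _); first by ring.
by apply: eq_bigr => j _; ring.
Qed.

Lemma kform_linear x : linear (kform lam x : _ -> R^o).
Proof.
move=> k y z; rewrite /kform !coordE [X in _ = X + _]/GRing.scale/= [in RHS]mulrDr [in RHS]mulr_sumr.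
rewrite [RHS]addrACA -big_split/=; congr (_ + _); first by ring.
by apply: eq_bigr => j _; rewrite !coordE; ring.
Qed.

Lemma kform_linearl y : linear ((kform lam)^~ y : _ -> R^o).
Proof. by move=> k x z; rewrite /= !(kformC _ y); exact: kform_linear. Qed.

Lemma lie_linear x : linear (lie lam x).
Proof.
move=> k y z; apply: osc_eqP => [||j|j]; rewrite ?coordE !mkE ?coordE; try ring.
rewrite mulr_sumr -big_split/=; apply: eq_bigr => j _; rewrite !coordE; ring.
Qed.

Lemma lieC x y : lie lam x y = - lie lam y x.
Proof.
apply: osc_eqP => [||j|j]; rewrite ?coordE !mkE; try ring.
rewrite -sumrN; apply: eq_bigr => j _; ring.
Qed.

Lemma lie_linearl y : linear ((lie lam)^~ y).
Proof.
by move=> k x z; rewrite /= !(lieC _ y) lie_linear opprD scalerN.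
Qed.

(** Ad-invariance: the weights [1 / lam j] of the form cancel the factors [lam j] of the bracket,
    leaving the same symplectic terms on both sides. *)
Lemma kform_lie x y z : (forall j, 0 < lam j) ->
  kform lam (lie lam x y) z = kform lam x (lie lam y z).
Proof.
move=> lam0; rewrite /kform /lie !mkE mulr0 addr0 mul0r add0r.
rewrite mulr_suml mulr_sumr -!big_split/=; apply: eq_bigr => j _.
by rewrite !mkE; field; rewrite gt_eqF.
Qed.

Lemma kform_nondeg x : (forall j, 0 < lam j) -> (forall y, kform lam x y = 0) -> x = 0.
Proof.
move=> lam0 h; apply: osc_eqP => [||i|i]; rewrite coordE.
- have := h (mkosc 0 1 (fun=> 0) (fun=> 0)); rewrite /kform !mkE.
  by rewrite big1 ?mulr1 ?mulr0 ?addr0// => j _; rewrite !mkE; ring.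
- have := h (mkosc 1 0 (fun=> 0) (fun=> 0)); rewrite /kform !mkE.
  by rewrite big1 ?mulr1 ?mulr0 ?addr0 ?add0r// => j _; rewrite !mkE; ring.
- have := h (mkosc 0 0 (fun j => (j == i)%:R) (fun=> 0)); rewrite /kform !mkE.
  rewrite (bigD1 i)//= big1 ?mulr0 ?addr0 ?add0r => [|j ji]; rewrite !mkE.
    rewrite eqxx mulr1 mulr0 addr0 => /eqP; rewrite mulf_eq0 invr_eq0 gt_eqF//=.
    by move/eqP.
  by rewrite (negbTE ji) mulr0n; ring.
- have := h (mkosc 0 0 (fun=> 0) (fun j => (j == i)%:R)); rewrite /kform !mkE.
  rewrite (bigD1 i)//= big1 ?mulr0 ?addr0 ?add0r => [|j ji]; rewrite !mkE.
    rewrite eqxx mulr1 mulr0 add0r => /eqP; rewrite mulf_eq0 invr_eq0 gt_eqF//=.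
    by move/eqP.
  by rewrite (negbTE ji) mulr0n; ring.
Qed.

(** The imaginary part of the standard Hermitian product on the complex coordinates. It is both the
    [e_0]-component of the bracket and, up to the factor 1/2 and a rotation, the cocycle of the
    group law. *)
Definition sympl x y : R := \sum_(j < n) (x_e x j * x_e' y j - x_e' x j * x_e y j).

Lemma symplC x y : sympl x y = - sympl y x.
Proof. by rewrite /sympl -sumrN; apply: eq_bigr => j _; ring. Qed.

Lemma sympl_linear (k : R) x y z : sympl x (k *: y + z) = k * sympl x y + sympl x z.
Proof.
rewrite /sympl mulr_sumr -big_split/=; apply: eq_bigr => j _.
by rewrite !coordE; ring.
Qed.

Lemma sympl_linearl (k : R) x y z : sympl (k *: y + z) x = k * sympl y x + sympl z x.
Proof. by rewrite !(symplC _ x) sympl_linear; ring. Qed.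

(* The left-invariant Maurer-Cartan form: [theta p] is the differential at [p]
   of left translation by the inverse of [p]. *)
Definition theta p xi : osc R n :=
  mkosc (x_m1 xi)
    (x_0 xi - 2^-1 * sympl p xi)
    (fun j => cos (x_m1 p * lam j) * x_e xi j + sin (x_m1 p * lam j) * x_e' xi j)
    (fun j => cos (x_m1 p * lam j) * x_e' xi j - sin (x_m1 p * lam j) * x_e xi j).

(** The value at [p] of the left-invariant vector field equal to [v] at the identity. *)
Definition thetaV p v : osc R n :=
  mkosc (x_m1 v)
    (x_0 v + 2^-1 * \sum_(j < n)
       (x_e p j * (cos (x_m1 p * lam j) * x_e' v j + sin (x_m1 p * lam j) * x_e v j) -
        x_e' p j * (cos (x_m1 p * lam j) * x_e v j - sin (x_m1 p * lam j) * x_e' v j)))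
    (fun j => cos (x_m1 p * lam j) * x_e v j - sin (x_m1 p * lam j) * x_e' v j)
    (fun j => cos (x_m1 p * lam j) * x_e' v j + sin (x_m1 p * lam j) * x_e v j).

(* [dtheta p eta xi] is the derivative of [theta ^~ xi] at [p] along [eta]. *)
Definition dtheta p eta xi : osc R n :=
  mkosc 0
    (- (2^-1 * sympl eta xi))
    (fun j => lam j * x_m1 eta *
       (cos (x_m1 p * lam j) * x_e' xi j - sin (x_m1 p * lam j) * x_e xi j))
    (fun j => - (lam j * x_m1 eta *
       (cos (x_m1 p * lam j) * x_e xi j + sin (x_m1 p * lam j) * x_e' xi j))).

Lemma theta_linear p : linear (theta p).
Proof.
move=> k y z; apply: osc_eqP => [||j|j]; rewrite ?coordE !mkE ?coordE ?sympl_linear; ring.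
Qed.

Lemma theta0 p : theta p 0 = 0.
Proof. by have := theta_linear p (-1) 0 0; rewrite scaleN1r oppr0 addr0 scaleN1r addNr. Qed.

Lemma thetaV0 p : thetaV p 0 = 0.
Proof.
apply: osc_eqP => [||j|j]; rewrite /thetaV !mkE !coordE; try ring.
by rewrite big1 ?mulr0 ?addr0// => j _; rewrite !coordE; ring.
Qed.

Lemma dtheta_linear p eta : linear (dtheta p eta).
Proof.
move=> k y z; apply: osc_eqP => [||j|j]; rewrite ?coordE !mkE ?coordE ?sympl_linear; ring.
Qed.

Lemma dtheta_linearl p xi : linear ((dtheta p)^~ xi).
Proof.
move=> k y z; apply: osc_eqP => [||j|j]; rewrite /= ?coordE !mkE ?coordE ?sympl_linearl; ring.
Qed.

Lemma thetaK p : cancel (theta p) (thetaV p).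
Proof.
move=> xi; apply: osc_eqP => [||j|j]; rewrite /thetaV !mkE //.
- rewrite -addrA -mulrN -mulrDr [X in _ + _ * X](_ : _ = 0) ?mulr0 ?addr0//.
  rewrite addrC /sympl -sumrB big1// => j _; rewrite !mkE.
  have := cos2Dsin2 (x_m1 p * lam j).
  set c := cos _; set s := sin _ => cs.
  transitivity ((c ^+ 2 + s ^+ 2 - 1) * (x_e p j * x_e' xi j - x_e' p j * x_e xi j)).
    by ring.
  by rewrite cs subrr mul0r.
- have := cos2Dsin2 (x_m1 p * lam j).
  set c := cos _; set s := sin _ => cs.
  transitivity ((c ^+ 2 + s ^+ 2) * x_e xi j); first by ring.
  by rewrite cs mul1r.
- have := cos2Dsin2 (x_m1 p * lam j).
  set c := cos _; set s := sin _ => cs.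
  transitivity ((c ^+ 2 + s ^+ 2) * x_e' xi j); first by ring.
  by rewrite cs mul1r.
Qed.

Lemma thetaVK p : cancel (thetaV p) (theta p).
Proof.
move=> v; apply: osc_eqP => [||j|j]; rewrite /theta !mkE //.
- by rewrite /sympl; under [X in _ - _ * X]eq_bigr do rewrite !mkE; rewrite addrK.
- have := cos2Dsin2 (x_m1 p * lam j).
  set c := cos _; set s := sin _ => cs.
  transitivity ((c ^+ 2 + s ^+ 2) * x_e v j); first by ring.
  by rewrite cs mul1r.
- have := cos2Dsin2 (x_m1 p * lam j).
  set c := cos _; set s := sin _ => cs.
  transitivity ((c ^+ 2 + s ^+ 2) * x_e' v j); first by ring.
  by rewrite cs mul1r.
Qed.

(* Maurer-Cartan equation. *)
Lemma dthetaB p eta xi :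
  dtheta p eta xi - dtheta p xi eta = - lie lam (theta p eta) (theta p xi).
Proof.
apply: osc_eqP => [||j|j]; rewrite ?coordE /dtheta /lie !mkE; try ring.
rewrite (symplC xi); transitivity (- sympl eta xi); first by field.
rewrite /sympl; congr (- _); apply: eq_bigr => j _.
rewrite !mkE; have := cos2Dsin2 (x_m1 p * lam j).
set c := cos _; set s := sin _ => cs.
transitivity ((c ^+ 2 + s ^+ 2) * (x_e eta j * x_e' xi j - x_e' eta j * x_e xi j)).
  by rewrite cs mul1r.
by ring.
Qed.

(** In these coordinates left translation is affine in its argument: based at [p], it is exactly the
    linear map [theta p]. The difference quotient is thus constant away from 0. *)
Lemma derive_left_translation p xi :
  'D_xi (omul lam (Defs.oinv lam p)) p = theta p xi.
Proof.
have e q : omul lam (Defs.oinv lam p) (q + p) = theta p q.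
  apply: osc_eqP => [||j|j]; rewrite /omul /Defs.oinv /mkoscC /theta !mkE ?coordE.
  - by rewrite addrC addrK.
  - rewrite (_ : - x_0 p + (x_0 q + x_0 p) = x_0 q); last by ring.
    congr (_ + _).
    rewrite -mulrN /sympl -sumrN; congr (_ * _); apply: eq_bigr => j _.
    rewrite /zcoord !mkE /= !coordE ?(mulNr (x_m1 p)) cosN sinN.
    have := cos2Dsin2 (x_m1 p * lam j).
    set c := cos _; set s := sin _ => cs.
    transitivity (- ((c ^+ 2 + s ^+ 2) * (x_e p j * x_e' q j - x_e' p j * x_e q j))).
      by ring.
    by rewrite cs mul1r.
  - by rewrite /zcoord !mkE /= !coordE ?(mulNr (x_m1 p)) cosN sinN; ring.
  - by rewrite /zcoord !mkE /= !coordE ?(mulNr (x_m1 p)) cosN sinN; ring.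
apply: cvg_lim => //; apply: cvg_near_cst; near=> h.
rewrite /= e -[X in _ - omul _ _ X]add0r e.
have -> : theta p (h *: xi) = h *: theta p xi.
  by have := theta_linear p h xi 0; rewrite !addr0 theta0 addr0.
rewrite theta0 subr0 scalerA mulVf ?scale1r//.
by near: h; exact: nbhs_dnbhs_neq.
Unshelve. all: by end_near. Qed.

Lemma is_derive_theta {V : normedModType R} (c g : V -> osc R n) (t w : V) dc dg :
  is_derive t w c dc -> is_derive t w g dg ->
  is_derive t w (fun s => theta (c s) (g s)) (dtheta (c t) dc (g t) + theta (c t) dg).
Proof.
move=> /is_derive_coords[c1 c2 c3 c4] /is_derive_coords[g1 g2 g3 g4].
have ang j : is_derive t w (fun s => x_m1 (c s) * lam j) (x_m1 dc * lam j).
  by have := is_derive_ptwM c1 (is_derive_cst (lam j) t w); rewrite mulr0 addr0.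
have dcos j := is_derive_comp_real (ang j) (is_derive_cos _).
have dsin j := is_derive_comp_real (ang j) (is_derive_sin _).
apply: is_derive_osc => [||j|j].
- rewrite coordE !mkE add0r.
  by congr (is_derive _ _ _ _) : g1; apply/funext => s; rewrite mkE.
- have h := is_derive_ptwB g2 (is_derive_ptwM (is_derive_cst (2^-1 : R) t w)
    (is_derive_ptw_sum (fun j => is_derive_ptwB (is_derive_ptwM (c3 j) (g4 j))
       (is_derive_ptwM (c4 j) (g3 j))))).
  have -> : (fun s => x_0 (theta (c s) (g s))) = (fun s => x_0 (g s) - 2^-1 *
       \sum_(j < n) (x_e (c s) j * x_e' (g s) j - x_e' (c s) j * x_e (g s) j)).
    by apply/funext => s; rewrite mkE.
  apply: is_derive_eq h _; rewrite /= coordE !mkE mul0r add0r.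
  rewrite [RHS]addrCA -opprD -mulrDr -big_split/=.
  by congr (_ - _ * _); apply: eq_bigr => j _; ring.
- have h := is_derive_ptwD (is_derive_ptwM (dcos j) (g3 j)) (is_derive_ptwM (dsin j) (g4 j)).
  have -> : (fun s => x_e (theta (c s) (g s)) j) = (fun s =>
     cos (x_m1 (c s) * lam j) * x_e (g s) j + sin (x_m1 (c s) * lam j) * x_e' (g s) j).
    by apply/funext => s; rewrite mkE.
  by apply: is_derive_eq h _; rewrite coordE !mkE; ring.
- have h := is_derive_ptwB (is_derive_ptwM (dcos j) (g4 j)) (is_derive_ptwM (dsin j) (g3 j)).
  have -> : (fun s => x_e' (theta (c s) (g s)) j) = (fun s =>
     cos (x_m1 (c s) * lam j) * x_e' (g s) j - sin (x_m1 (c s) * lam j) * x_e (g s) j).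
    by apply/funext => s; rewrite mkE.
  by apply: is_derive_eq h _; rewrite coordE !mkE; ring.
Qed.

(** This gives a second derivative to curves reconstructed from [v]. No formula for it is required,
    as [theta] applied to the velocity returns [v], whose derivative is known. *)
Lemma derivable_thetaV (c g : R -> osc R n) (t : R) dc dg :
  is_derive t 1 c dc -> is_derive t 1 g dg ->
  derivable (fun s => thetaV (c s) (g s)) t 1.
Proof.
move=> /is_derive_coords[c1 c2 c3 c4] /is_derive_coords[g1 g2 g3 g4].
have ang j : is_derive t 1 (fun s => x_m1 (c s) * lam j) (x_m1 dc * lam j).
  by have := is_derive_ptwM c1 (is_derive_cst (lam j) t 1); rewrite mulr0 addr0.
have dcos j := is_derive_comp_real (ang j) (is_derive_cos _).
have dsin j := is_derive_comp_real (ang j) (is_derive_sin _).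
apply/derivable_mxP => i k; rewrite ord1 {i}; move: k; apply: osc_indexP => [||j|j].
- have -> : (fun s => thetaV (c s) (g s) 0 (lshift (n + n) (lshift 1 ord0))) = (fun s => x_m1 (g s)).
    by apply/funext => s; rewrite -[LHS]/(x_m1 (thetaV (c s) (g s))) mkE.
  by have [] := g1.
- have -> : (fun s => thetaV (c s) (g s) 0 (lshift (n + n) (rshift 1 ord0))) =
      (fun s => x_0 (g s) + 2^-1 * \sum_(j < n)
       (x_e (c s) j * (cos (x_m1 (c s) * lam j) * x_e' (g s) j + sin (x_m1 (c s) * lam j) * x_e (g s) j) -
        x_e' (c s) j * (cos (x_m1 (c s) * lam j) * x_e (g s) j - sin (x_m1 (c s) * lam j) * x_e' (g s) j))).
    by apply/funext => s; exact: x_0_mk.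
  have [h _] := is_derive_ptwD g2 (is_derive_ptwM (is_derive_cst (2^-1 : R) t 1)
    (is_derive_ptw_sum (fun j => is_derive_ptwB
      (is_derive_ptwM (c3 j) (is_derive_ptwD (is_derive_ptwM (dcos j) (g4 j)) (is_derive_ptwM (dsin j) (g3 j))))
      (is_derive_ptwM (c4 j) (is_derive_ptwB (is_derive_ptwM (dcos j) (g3 j)) (is_derive_ptwM (dsin j) (g4 j))))))).
  exact: h.
- have -> : (fun s => thetaV (c s) (g s) 0 (rshift (1 + 1) (lshift n j))) =
      (fun s => cos (x_m1 (c s) * lam j) * x_e (g s) j - sin (x_m1 (c s) * lam j) * x_e' (g s) j).
    by apply/funext => s; exact: x_e_mk.
  have [h _] := is_derive_ptwB (is_derive_ptwM (dcos j) (g3 j)) (is_derive_ptwM (dsin j) (g4 j)).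
  exact: h.
- have -> : (fun s => thetaV (c s) (g s) 0 (rshift (1 + 1) (rshift n j))) =
      (fun s => cos (x_m1 (c s) * lam j) * x_e' (g s) j + sin (x_m1 (c s) * lam j) * x_e (g s) j).
    by apply/funext => s; exact: x_e'_mk.
  have [h _] := is_derive_ptwD (is_derive_ptwM (dcos j) (g4 j)) (is_derive_ptwM (dsin j) (g3 j)).
  exact: h.
Qed.

End OscillatorAlgebra.

(** * From Christoffel symbols to the Euler equation *)

Section GeodesicEquation.
Context {R : realType} {n : nat}.
Variables (lam : 'I_n -> R) (u : {linear osc R n -> osc R n}).
Hypothesis lam0 : forall j, 0 < lam j.
Hypothesis ubij : bijective u.
Hypothesis usym : k_symmetric lam u.
Implicit Types (x y z p xi eta v a : osc R n).

Local Notation b x y := (kform lam (u x) y).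

Lemma kuE p i j : ku_metric lam u p i j =
  b (theta lam p (delta_mx 0 i)) (theta lam p (delta_mx 0 j)).
Proof. by rewrite mxE !derive_left_translation. Qed.

Lemma kform_u_linear x : linear ((fun y => b x y) : _ -> R^o).
Proof. exact: kform_linear. Qed.

Lemma kform_u_linearl y : linear ((fun x => b x y) : _ -> R^o).
Proof. by move=> k x z; rewrite linearP; exact: kform_linearl. Qed.

Lemma kform_uC x y : b x y = b y x.
Proof. by rewrite usym kformC. Qed.

Lemma kform_u_nondeg x : (forall y, b x y = 0) -> x = 0.
Proof.
by move=> /(kform_nondeg lam0) h; apply: (bij_inj ubij); rewrite h linear0.
Qed.

Definition dku p eta x y : R :=
  b (dtheta lam p eta x) (theta lam p y) + b (theta lam p x) (dtheta lam p eta y).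

Lemma partial_ku p k i j :
  partial k (fun q => ku_metric lam u q i j) p =
  dku p (delta_mx 0 k) (delta_mx 0 i) (delta_mx 0 j).
Proof.
have dth xi : is_derive p (delta_mx 0 k) (fun q => theta lam q xi)
    (dtheta lam p (delta_mx 0 k) xi).
  have := is_derive_theta lam (is_derive_id p (delta_mx 0 k)) (is_derive_cst xi p (delta_mx 0 k)).
  by rewrite theta0 addr0.
rewrite /partial.
have -> : (fun q => ku_metric lam u q i j) =
    (fun q => b (theta lam q (delta_mx 0 i)) (theta lam q (delta_mx 0 j))).
  by apply/funext => q; exact: kuE.
by have [_ ->] := bilinear_is_derive kform_u_linear kform_u_linearl (dth (delta_mx 0 i)) (dth (delta_mx 0 j)).
Qed.

(** [theta p] is onto and [kform lam (u x) y] is nondegenerate. Since [invmx] is a true inverse only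
    on invertible matrices, lowering the index of a Christoffel symbol relies on this. *)
Lemma ku_unitmx p : ku_metric lam u p \in unitmx.
Proof.
rewrite -row_free_unit -kermx_eq0; apply/rowV0P => v /sub_kermxP hv.
have h y : b (theta lam p v) (theta lam p y) = 0.
  rewrite (@bilinear_delta_expand R _ (fun v y => b (theta lam p v) (theta lam p y))); first last.
  - move=> x k w z /=; rewrite theta_linear; exact: kform_u_linearl.
  - move=> x k w z /=; rewrite theta_linear; exact: kform_u_linear.
  rewrite exchange_big big1 => // j _ /=.
  rewrite -mulr_suml; move/rowP/(_ j) : hv; rewrite !mxE => hv.
  rewrite [X in X * _](_ : _ = 0) ?mul0r// -[RHS]hv; apply: eq_bigr => i _.
  by rewrite kuE mulrC.
have /(congr1 (thetaV lam p)) : theta lam p v = 0.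
  by apply: kform_u_nondeg => y; rewrite -(thetaVK lam p y).
by rewrite thetaK thetaV0.
Qed.

(** On the diagonal, symmetry of the metric collects the derivatives of [theta] into
    [dtheta p xi l - dtheta p l xi] plus one symmetric term. The Maurer-Cartan equation turns that
    difference into a bracket. *)
Lemma christoffel_sum p xi k :
  \sum_i \sum_j christoffel (ku_metric lam u) k i j p * xi 0 i * xi 0 j =
  \sum_l invmx (ku_metric lam u p) k l *
    (b (dtheta lam p xi xi) (theta lam p (delta_mx 0 l)) -
     b (theta lam p xi) (lie lam (theta lam p xi) (theta lam p (delta_mx 0 l)))).
Proof.
pose C l x y : R := 2^-1 * (dku p x y (delta_mx 0 l) + dku p y x (delta_mx 0 l)
  - dku p (delta_mx 0 l) x y).
have dku1 k' x x' y z : dku p (k' *: x + x') y z = k' * dku p x y z + dku p x' y z.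
  by rewrite /dku !dtheta_linearl kform_u_linearl kform_u_linear /GRing.scale/=; ring.
have dku2 k' x x' y z : dku p y (k' *: x + x') z = k' * dku p y x z + dku p y x' z.
  rewrite /dku !dtheta_linear !theta_linear.
  by rewrite [b (_ + _) (theta _ _ z)]kform_u_linearl kform_u_linearl /GRing.scale/=; ring.
have dku3 k' x x' y z : dku p y z (k' *: x + x') = k' * dku p y z x + dku p y z x'.
  rewrite /dku !dtheta_linear !theta_linear.
  by rewrite !kform_u_linear /GRing.scale/=; ring.
have CE l : C l xi xi = b (dtheta lam p xi xi) (theta lam p (delta_mx 0 l)) -
     b (theta lam p xi) (lie lam (theta lam p xi) (theta lam p (delta_mx 0 l))).
  have := dthetaB lam p xi (delta_mx 0 l).
  move/eqP; rewrite subr_eq => /eqP e.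
  rewrite /C /dku e -scaleN1r kform_u_linear (kform_uC (dtheta lam p (delta_mx 0 l) xi)) /GRing.scale/=.
  by field.
transitivity (\sum_i \sum_j \sum_l invmx (ku_metric lam u p) k l *
   (C l (delta_mx 0 i) (delta_mx 0 j) * xi 0 i * xi 0 j)).
  apply: eq_bigr => i _; apply: eq_bigr => j _.
  rewrite /christoffel mulr_sumr !mulr_suml; apply: eq_bigr => l _.
  by rewrite !partial_ku /C; ring.
under eq_bigr do rewrite exchange_big /=.
rewrite exchange_big /=; apply: eq_bigr => l _.
rewrite -CE (@bilinear_delta_expand R _ (C l)) => [|x k' y z|y k' x z].
- by rewrite mulr_sumr; apply: eq_bigr => i _; rewrite mulr_sumr.
- by rewrite /C dku1 dku2 dku3 /GRing.scale/=; ring.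
- by rewrite /C dku1 dku2 dku2 /GRing.scale/=; ring.
Qed.

(** For [xi] the velocity and [a] the acceleration, [dtheta p xi xi + theta p a] is the derivative
    of [v]. The index is lowered with the Gram matrix, ad-invariance moves the bracket onto [u v],
    and nondegeneracy removes the test vectors [theta p (delta_mx 0 l)]. *)
Lemma geodesic_equation_euler p xi a :
  (forall k, a 0 k + \sum_i \sum_j
     christoffel (ku_metric lam u) k i j p * xi 0 i * xi 0 j = 0) <->
  u (dtheta lam p xi xi + theta lam p a) =
  lie lam (u (theta lam p xi)) (theta lam p xi).
Proof.
pose g := ku_metric lam u p.
pose T := \col_l (b (dtheta lam p xi xi) (theta lam p (delta_mx 0 l)) -
     b (theta lam p xi) (lie lam (theta lam p xi) (theta lam p (delta_mx 0 l)))).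
have gu : g \in unitmx := ku_unitmx p.
have gT l : (g *m a^T) l 0 = b (theta lam p a) (theta lam p (delta_mx 0 l)).
  rewrite kform_uC.
  have la : linear ((fun z => b (theta lam p (delta_mx 0 l)) (theta lam p z)) : _ -> R^o).
    by move=> k x y; rewrite theta_linear; exact: kform_u_linear.
  rewrite (linear_delta_expand la) mxE; apply: eq_bigr => k _.
  by rewrite kuE mxE /GRing.scale/= mulrC.
have h1 : (forall k, a 0 k + \sum_i \sum_j
     christoffel (ku_metric lam u) k i j p * xi 0 i * xi 0 j = 0) <->
    a^T + invmx g *m T = 0.
  split=> [h|/matrixP h k].
    apply/matrixP => k j; rewrite (ord1 j) !mxE -[RHS](h k) christoffel_sum.
    by congr (_ + _); apply: eq_bigr => l _; rewrite mxE.
  rewrite christoffel_sum; have := h k 0; rewrite !mxE => hk; rewrite -[RHS]hk.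
  by congr (_ + _); apply: eq_bigr => l _; rewrite mxE.
have h2 : a^T + invmx g *m T = 0 <-> g *m a^T + T = 0.
  split=> h.
    by have := congr1 (mulmx g) h; rewrite mulmxDr mulKVmx// mulmx0.
  by have := congr1 (mulmx (invmx g)) h; rewrite mulmxDr mulKmx// mulmx0.
have h3 l : (g *m a^T + T) l 0 =
    kform lam (u (dtheta lam p xi xi + theta lam p a) -
      lie lam (u (theta lam p xi)) (theta lam p xi)) (theta lam p (delta_mx 0 l)).
  have -> : (g *m a^T + T) l 0 = (g *m a^T) l 0 + T l 0 by rewrite mxE.
  rewrite gT mxE addrC -[X in X - _]scale1r.
  have e := kform_linearl lam (theta lam p (delta_mx 0 l)).
  have -> : (u (dtheta lam p xi xi + theta lam p a) -
      lie lam (u (theta lam p xi)) (theta lam p xi)) =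
      (-1) *: lie lam (u (theta lam p xi)) (theta lam p xi) +
      (1 *: u (dtheta lam p xi xi) + u (theta lam p a)).
    by rewrite scaleN1r scale1r linearD addrC.
  by rewrite e e kform_lie// /GRing.scale/=; ring.
apply: (iff_trans h1); apply: (iff_trans h2); split=> [/matrixP h|h].
  apply/eqP; rewrite -subr_eq0; apply/eqP; apply: kform_nondeg => // y.
  rewrite -(thetaVK lam p y).
  have ly : linear ((fun z => kform lam (u (dtheta lam p xi xi + theta lam p a) -
      lie lam (u (theta lam p xi)) (theta lam p xi)) (theta lam p z)) : _ -> R^o).
    by move=> k x z; rewrite theta_linear; exact: kform_linear.
  rewrite (linear_delta_expand ly) big1// => l _.
  by rewrite -h3 (h l 0) [X in _ *: X]mxE scaler0.
apply/matrixP => l j; rewrite (ord1 j) h3 h subrr mxE.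
have := kform_linearl lam (theta lam p (delta_mx 0 l)) (-1) 0 0.
by rewrite scaleN1r oppr0 addr0 scaleN1r addNr.
Qed.

End GeodesicEquation.

(** * The a priori bound and global solutions of the Euler equation *)

Section EulerGlobal.
Context {R : realType} {n : nat}.
Variables (lam : 'I_n -> R) (w_inv : osc R n -> osc R n) (X : osc R n).
Implicit Types (x y z p w a b : osc R n).

Definition e_0 : osc R n := mkosc 0 1 (fun=> 0) (fun=> 0).

(** The pair [(p, y)], stored in the ambient space with zero [e_0]-coordinate so that the bounds for
    linear and bilinear maps on row vectors apply to it directly. *)
Definition horizontal a : osc R n :=
  mkosc (x_m1 a) 0 (fun j => x_e a j - x_m1 a * x_e X j)
    (fun j => x_e' a j - x_m1 a * x_e' X j).

Definition unhorizontal a : osc R n :=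
  mkosc (x_m1 a) 0 (fun j => x_e a j + x_m1 a * x_e X j)
    (fun j => x_e' a j + x_m1 a * x_e' X j).

Hypothesis inv_linear : linear w_inv.
(* [X] is [w_inv e_0] scaled to have first coordinate 1, or 0 (any vector would do) if
   [w_inv e_0] is central. *)
Hypothesis inv_e_0 : forall j,
  x_e (w_inv e_0) j = x_m1 (w_inv e_0) * x_e X j /\
  x_e' (w_inv e_0) j = x_m1 (w_inv e_0) * x_e' X j.

Lemma osc_sum (F : 'I_(osc_dim n) -> R) : \sum_i F i =
  F (lshift (n + n) (lshift 1 ord0)) + F (lshift (n + n) (rshift 1 ord0)) +
  \sum_(j < n) (F (rshift (1 + 1) (lshift n j)) + F (rshift (1 + 1) (rshift n j))).
Proof. by rewrite !big_split_ord/= !big_ord1 big_split. Qed.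

Lemma unhorizontal_linear : linear unhorizontal.
Proof.
by move=> k y z; apply: osc_eqP => [||j|j]; rewrite ?coordE !mkE ?coordE; ring.
Qed.

Lemma horizontalK w : w = unhorizontal (horizontal w) + x_0 w *: e_0.
Proof.
by apply: osc_eqP => [||j|j]; rewrite coordE !mkE coordE !mkE; ring.
Qed.

Let zeta b j := x_e (w_inv (unhorizontal b)) j - x_m1 (w_inv (unhorizontal b)) * x_e X j.
Let zeta' b j := x_e' (w_inv (unhorizontal b)) j - x_m1 (w_inv (unhorizontal b)) * x_e' X j.

(** [w] and [unhorizontal (horizontal w)] differ by a multiple of [e_0], and the complex part of
    [w_inv e_0] is parallel to that of [X]. Hence [w_0] enters the complex part of [v] only through
    [x_m1 v]. *)
Lemma inv_horizontal w j : let v := w_inv w in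
  x_e v j = zeta (horizontal w) j + x_m1 v * x_e X j /\
  x_e' v j = zeta' (horizontal w) j + x_m1 v * x_e' X j.
Proof.
move=> /=; rewrite /zeta /zeta'; set h := horizontal w.
have -> : w_inv w = x_0 w *: w_inv e_0 + w_inv (unhorizontal h).
  by rewrite -inv_linear addrC -horizontalK.
have [e e'] := inv_e_0 j.
by rewrite !coordE e e'; split; ring.
Qed.

(** The pairing of [y] with its forcing term: [2 * p * beta h h], with [h] the pair [(p, y)], is the
    growth rate of the sum of squares along the unslowed flow. *)
Let beta a b : R := \sum_j lam j * (x_e' a j * zeta b j - x_e a j * zeta' b j).

Lemma euler_apriori (w0 : osc R n) (t0 T : R) : exists C,
  forall (x : R -> osc R n) (phi : R -> R), (forall t, 0 <= phi t <= 1) ->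
  x t0 = w0 -> (forall t : R, is_derive t 1 x (phi t *: lie lam (x t) (w_inv (x t)))) ->
  forall t, `|t - t0| <= T -> `|x t| <= C.
Proof.
have zeta_lin k a b j : zeta (k *: a + b) j = k * zeta a j + zeta b j.
  by rewrite /zeta unhorizontal_linear inv_linear !coordE; ring.
have zeta'_lin k a b j : zeta' (k *: a + b) j = k * zeta' a j + zeta' b j.
  by rewrite /zeta' unhorizontal_linear inv_linear !coordE; ring.
have [K K0 hK] : exists2 K, 0 <= K & forall a b, `|beta a b| <= K * `|a| * `|b|.
  apply: (@bilinear_bounded R _ R^o beta) => [a k b c|b k a c].
    rewrite /beta [X in _ = X + _]/GRing.scale/= mulr_sumr -big_split/=.
    by apply: eq_bigr => j _; rewrite zeta_lin zeta'_lin; ring.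
  rewrite /beta [X in _ = X + _]/GRing.scale/= mulr_sumr -big_split/=.
  by apply: eq_bigr => j _; rewrite !coordE; ring.
have [KS KS0 hKS] := linear_bounded unhorizontal_linear.
have [K2 K20 hK2] : exists2 K, 0 <= K &
    forall a b, `|lie lam a (w_inv b)| <= K * `|a| * `|b|.
  apply: bilinear_bounded => [a k b c|b k a c]; first by rewrite inv_linear lie_linear.
  exact: lie_linearl.
(* The constant [x_m1 w ^+ 2] is included because [beta] also sees [p]: only the square of the full
   pair dominates it. *)
pose psi w := x_m1 w ^+ 2 + \sum_j ((x_e w j - x_m1 w * x_e X j) ^+ 2
  + (x_e' w j - x_m1 w * x_e' X j) ^+ 2).
have psi_norm w : `|horizontal w| ^+ 2 <= psi w.
  apply: (le_trans (sqr_norm_le_sum _)); rewrite osc_sum.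
  rewrite -[horizontal w 0 _]/(x_m1 (horizontal w)) -[X in _ + X ^+ 2 + _]/(x_0 (horizontal w)).
  rewrite !mkE expr0n addr0 lerD2l; apply: ler_sum => j _.
  rewrite -[X in X ^+ 2 + _ <= _]/(x_e (horizontal w) j) -[X in _ + X ^+ 2 <= _]/(x_e' (horizontal w) j).
  by rewrite !mkE.
pose c1 := 2 * `|x_m1 w0| * K.
have c10 : 0 <= c1 by rewrite !mulr_ge0.
pose Psi := psi w0 * expR (c1 * T).
(* [|h| <= 1 + |h| ^+ 2] bounds the norm by [1 + Psi] without a square root. *)
have [M1 M1E] : exists M1, M1 = KS * (1 + Psi) by exists (KS * (1 + Psi)).
pose c2 := 2 * (K2 * M1 * (M1 + `|e_0|)).
(* [chi] dominates both [|x_0 w|] and [x_0 w ^+ 2], so the affine bound on the derivative of [w_0]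
   becomes a homogeneous one, with constant [c2]. *)
pose chi w := 1 + x_0 w ^+ 2.
exists (M1 + chi w0 * expR (c2 * T) * `|e_0|) => x phi hphi x0 dx.
have coords t := is_derive_coords (dx t).
have m1 t : x_m1 (x t) = x_m1 w0.
  apply: (@eq_is_derive_eq R (fun t => x_m1 (x t)) (fun=> x_m1 w0) (fun=> 0) setT _ _ _ t0 t) => //.
  - by move=> s _; have [+ _ _ _] := coords s; rewrite coordE !mkE mulr0.
  - by rewrite x0.
have psi0 w : 0 <= psi w by apply: le_trans (psi_norm w); exact: sqr_ge0.
have hpsi t : psi (x t) <= psi w0 * expR (c1 * `|t - t0|).
  rewrite -x0.
  apply: (@gronwall R (psi \o x) (fun t => 2 * phi t * x_m1 (x t) * beta (horizontal (x t)) (horizontal (x t))) setT c1) => //.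
  - move=> s _; have [d1 d2 d3 d4] := coords s.
    have hsq (f : R -> R) df : is_derive s 1 f df -> is_derive s 1 (fun t => f t ^+ 2) (2 * f s * df).
      by move=> hf; apply: is_derive_eq (is_derive_ptwM hf hf) _; ring.
    have cX (c : R) := is_derive_cst c s (1 : R).
    have h := is_derive_ptwD (hsq _ _ d1) (is_derive_ptw_sum (fun j => is_derive_ptwD
      (hsq _ _ (is_derive_ptwB (d3 j) (is_derive_ptwM d1 (cX (x_e X j)))))
      (hsq _ _ (is_derive_ptwB (d4 j) (is_derive_ptwM d1 (cX (x_e' X j))))))).
    apply: is_derive_eq h _; rewrite !coordE !mkE mulr0 mulr0 add0r /beta mulr_sumr.
    apply: eq_bigr => j _; rewrite !coordE !mkE /=.
    (* After this substitution all terms in [x_m1] of the velocity cancel: those along [X] against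
       each other, the remaining one by skewness. *)
    have [-> ->] := inv_horizontal (x s) j.
    by ring.
  - move=> s _; rewrite /= m1 !normrM normr_nat /c1.
    have /andP[f0 f1] := hphi s; rewrite (ger0_norm f0).
    have h1 : `|beta (horizontal (x s)) (horizontal (x s))| <= K * psi (x s).
      by apply: (le_trans (hK _ _)); rewrite -mulrA ler_wpM2l// -expr2.
    rewrite -!mulrA ler_wpM2l//; apply: (@le_trans _ _ (1 * (`|x_m1 w0| * (K * psi (x s))))).
      by apply: ler_pM => //; rewrite ?mulr_ge0 ?ler_wpM2l.
    by rewrite mul1r.
have hM1 t : `|t - t0| <= T -> `|unhorizontal (horizontal (x t))| <= M1.
  move=> tT; apply: (le_trans (hKS _)); rewrite M1E ler_wpM2l//.
  have hP : `|horizontal (x t)| ^+ 2 <= Psi.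
    apply: (le_trans (psi_norm _)); apply: (le_trans (hpsi t)).
    by rewrite ler_wpM2l// ler_expR ler_wpM2l.
  have := normr_ge0 (horizontal (x t)); nra.
have hx t : `|t - t0| <= T -> `|x t| <= M1 + `|x_0 (x t)| * `|e_0|.
  move=> tT; rewrite [in leLHS](horizontalK (x t)).
  by apply: (le_trans (ler_normD _ _)); rewrite normrZ lerD2r hM1.
move=> t tT.
have T0 : 0 <= T := le_trans (normr_ge0 _) tT.
have M10 : 0 <= M1 := le_trans (normr_ge0 _) (hM1 _ tT).
have c20 : 0 <= c2 by apply: mulr_ge0 => //; apply: mulr_ge0; [apply: mulr_ge0|apply: addr_ge0].
have abs_chi w : `|x_0 w| <= chi w.
  by rewrite /chi -real_normK ?num_real//; have := normr_ge0 (x_0 w); nra.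
have hchi : chi (x t) <= chi w0 * expR (c2 * `|t - t0|).
  rewrite -x0.
  apply: (@gronwall R (chi \o x) (fun t => 2 * x_0 (x t) * (phi t * x_0 (lie lam (x t) (w_inv (x t))))) [set s | `|s - t0| <= T] c2) => //=; last by rewrite subrr normr0.
  - move=> r s /= + + z /andP[rz zs].
    by rewrite !ler_distl => /andP[h1 h2] /andP[h3 h4]; apply/andP; split; lra.
  - move=> s _; have [_ d2 _ _] := coords s.
    have h := is_derive_ptwD (is_derive_cst (1 : R) s (1 : R)) (is_derive_ptwM d2 d2).
    by apply: is_derive_eq h _; rewrite coordE; ring.
  - move=> s sT; have /andP[f0 f1] := hphi s.
    have e0c b : lie lam e_0 b = 0.
      apply: osc_eqP => [||j|j]; rewrite coordE !mkE; try ring.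
      by rewrite big1// => j _; rewrite !mkE; ring.
    (* Dropping the [e_0]-part of the first argument leaves a vector bounded by [M1], so the bracket
       grows at most linearly in [w_0]. *)
    have hl : `|x_0 (lie lam (x s) (w_inv (x s)))| <= K2 * M1 * (M1 + `|x_0 (x s)| * `|e_0|).
      have -> : lie lam (x s) (w_inv (x s)) =
          lie lam (unhorizontal (horizontal (x s))) (w_inv (x s)).
        rewrite {1}(horizontalK (x s)) addrC.
        have /= -> := lie_linearl lam (w_inv (x s)) (x_0 (x s)) e_0 (unhorizontal (horizontal (x s))).
        by rewrite e0c scaler0 add0r.
      apply: (le_trans (ler_coord_norm _ _)); apply: (le_trans (hK2 _ _)).
      rewrite -!mulrA ler_wpM2l//; apply: ler_pM => //; [exact: hM1|exact: hx].
    rewrite !normrM normr_nat (ger0_norm f0).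
    have h1 : phi s * `|x_0 (lie lam (x s) (w_inv (x s)))| <= K2 * M1 * (M1 + `|x_0 (x s)| * `|e_0|).
      by apply: le_trans hl; rewrite ler_piMl.
    rewrite /c2 -!mulrA ler_wpM2l//.
    apply: (@le_trans _ _ (`|x_0 (x s)| * (K2 * M1 * (M1 + `|x_0 (x s)| * `|e_0|)))).
      by rewrite ler_wpM2l.
    rewrite mulrCA -!mulrA ler_wpM2l// ler_wpM2l// mulrDr mulrDl lerD//.
      by rewrite mulrC ler_wpM2l// abs_chi.
    rewrite mulrA mulrC ler_wpM2l// -expr2 real_normK ?num_real//.
    by rewrite /chi lerDr.
apply: (le_trans (hx _ tT)); rewrite lerD2l ler_wpM2r//.
apply: (le_trans (abs_chi _)); apply: (le_trans hchi).
have chi0 : 0 <= chi w0 by rewrite addr_ge0// sqr_ge0.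
by rewrite ler_wpM2l// ler_expR ler_wpM2l.
Qed.

Lemma euler_locally_lipschitz : locally_lipschitz (fun w => lie lam w (w_inv w)).
Proof.
apply: (@quadratic_locally_lipschitz R _ (fun a b => lie lam a (w_inv b))) => [a k b c|b k a c].
  by rewrite inv_linear lie_linear.
exact: lie_linearl.
Qed.

Lemma euler_global (w0 : osc R n) (t0 : R) : exists w : R -> osc R n,
  w t0 = w0 /\ forall t : R, is_derive t 1 w (lie lam (w t) (w_inv (w t))).
Proof.
exact: (ode_global euler_locally_lipschitz (euler_apriori w0 t0)).
Qed.

End EulerGlobal.

(** * Recovering the curve from its velocity at the identity *)

Section Reconstruction.
Context {R : realType} {n : nat}.
Variable lam : 'I_n -> R.

(** The system is triangular: the velocity of [x_m1] does not involve the position, that of the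
    complex coordinates involves only [x_m1], and that of [x_0] only these. Primitives taken in this
    order suffice. *)
Lemma position_exists (v dv : R -> osc R n) (t0 : R) (p0 : osc R n) :
  (forall t : R, is_derive t 1 v (dv t)) ->
  exists c, c t0 = p0 /\ forall t : R, is_derive t 1 c (thetaV lam (c t) (v t)).
Proof.
move=> hv; have dvc t := is_derive_coords (hv t).
have v_m1 (t : R) : is_derive t 1 (fun t => x_m1 (v t)) (x_m1 (dv t)) by have [] := dvc t.
have v_0 (t : R) : is_derive t 1 (fun t => x_0 (v t)) (x_0 (dv t)) by have [] := dvc t.
have v_e (t : R) j : is_derive t 1 (fun t => x_e (v t) j) (x_e (dv t) j) by have [] := dvc t.
have v_e' (t : R) j : is_derive t 1 (fun t => x_e' (v t) j) (x_e' (dv t) j) by have [] := dvc t.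
have [tau [tau0 dtau]] : exists P : R -> R, P t0 = x_m1 p0 /\ forall t : R, is_derive t 1 P (x_m1 (v t)).
  by apply: continuous_has_primitive; apply: derivable_continuous => t; case: (v_m1 t).
have ang (t : R) j : is_derive t 1 (fun s => tau s * lam j) (x_m1 (v t) * lam j).
  by have := is_derive_ptwM (dtau t) (is_derive_cst (lam j) t 1); rewrite mulr0 addr0.
have dcos (t : R) j := is_derive_comp_real (ang t j) (is_derive_cos _).
have dsin (t : R) j := is_derive_comp_real (ang t j) (is_derive_sin _).
pose E j t := cos (tau t * lam j) * x_e (v t) j - sin (tau t * lam j) * x_e' (v t) j.
pose E' j t := cos (tau t * lam j) * x_e' (v t) j + sin (tau t * lam j) * x_e (v t) j.
have dE j t : exists d, is_derive (t : R) 1 (E j) d.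
  eexists; exact: (is_derive_ptwB (is_derive_ptwM (dcos t j) (v_e t j)) (is_derive_ptwM (dsin t j) (v_e' t j))).
have dE' j t : exists d, is_derive (t : R) 1 (E' j) d.
  eexists; exact: (is_derive_ptwD (is_derive_ptwM (dcos t j) (v_e' t j)) (is_derive_ptwM (dsin t j) (v_e t j))).
have /choice[z hz] j : exists P : R -> R, P t0 = x_e p0 j /\ forall t : R, is_derive t 1 P (E j t).
  apply: continuous_has_primitive; apply: derivable_continuous => t.
  by have [d []] := dE j t.
have /choice[z' hz'] j : exists P : R -> R, P t0 = x_e' p0 j /\ forall t : R, is_derive t 1 P (E' j t).
  apply: continuous_has_primitive; apply: derivable_continuous => t.
  by have [d []] := dE' j t.
pose S t := x_0 (v t) + 2^-1 * \sum_j (z j t * E' j t - z' j t * E j t).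
have [s [s0 ds]] : exists P : R -> R, P t0 = x_0 p0 /\ forall t : R, is_derive t 1 P (S t).
  apply: continuous_has_primitive; apply: derivable_continuous => t.
  have /choice[D hD] j := dE j t; have /choice[D' hD'] j := dE' j t.
  have [h _] := is_derive_ptwD (v_0 t) (is_derive_ptwM (is_derive_cst (2^-1 : R) t (1 : R))
    (is_derive_ptw_sum (fun j => is_derive_ptwB
      (is_derive_ptwM ((hz j).2 t) (hD' j)) (is_derive_ptwM ((hz' j).2 t) (hD j))))).
  exact: h.
pose c t := mkosc (tau t) (s t) (z^~ t) (z'^~ t).
have cE t : [/\ x_m1 (c t) = tau t, x_0 (c t) = s t, x_e (c t) =1 z^~ t & x_e' (c t) =1 z'^~ t].
  exact: mkoscK.
exists c; split.
  have [c1 c2 c3 c4] := cE t0.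
  by apply: osc_eqP => [||j|j]; rewrite ?c1 ?c2 ?c3 ?c4 ?(hz j).1 ?(hz' j).1.
move=> t; have [c1 c2 c3 c4] := cE t; apply: is_derive_osc => [||j|j].
- have -> : (fun w => x_m1 (c w)) = tau by apply/funext => r; have [] := cE r.
  by rewrite x_m1_mk.
- have -> : (fun w => x_0 (c w)) = s by apply/funext => r; have [] := cE r.
  have -> : x_0 (thetaV lam (c t) (v t)) = S t; last exact: ds.
  rewrite x_0_mk /S; congr (_ + _ * _); apply: eq_bigr => j _.
  by rewrite c3 c4 c1.
- have -> : (fun w => x_e (c w) j) = z j by apply/funext => r; have [_ _ ->] := cE r.
  rewrite x_e_mk c1; exact: (hz j).2.
- have -> : (fun w => x_e' (c w) j) = z' j by apply/funext => r; have [_ _ _ ->] := cE r.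
  rewrite x_e'_mk c1; exact: (hz' j).2.
Qed.

(** The triangular order again: once the earlier coordinates agree, the next ones have equal
    derivatives. *)
Lemma position_unique (J : set R) (v c d : R -> osc R n) : is_interval J ->
  (forall t : R, J t -> is_derive t 1 c (thetaV lam (c t) (v t))) ->
  (forall t : R, J t -> is_derive t 1 d (thetaV lam (d t) (v t))) ->
  forall s t, J s -> J t -> c s = d s -> c t = d t.
Proof.
move=> iJ hc hd s t Js Jt e.
have m1 r : J r -> x_m1 (c r) = x_m1 (d r).
  move=> Jr; apply: (@eq_is_derive_eq R (fun r => x_m1 (c r)) (fun r => x_m1 (d r))
    (fun r => x_m1 (v r)) J iJ _ _ s r Js Jr); last by rewrite e.
    by move=> q Jq; have [] := is_derive_coords (hc _ Jq); rewrite x_m1_mk.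
  by move=> q Jq; have [] := is_derive_coords (hd _ Jq); rewrite x_m1_mk.
have me r j : J r -> x_e (c r) j = x_e (d r) j.
  move=> Jr; apply: (@eq_is_derive_eq R (fun r => x_e (c r) j) (fun r => x_e (d r) j)
    (fun r => x_e (thetaV lam (c r) (v r)) j) J iJ _ _ s r Js Jr); last by rewrite e.
    by move=> q Jq; have [_ _ + _] := is_derive_coords (hc _ Jq).
  move=> q Jq; have [_ _ + _] := is_derive_coords (hd _ Jq) => /(_ j).
  by rewrite !x_e_mk m1.
have me' r j : J r -> x_e' (c r) j = x_e' (d r) j.
  move=> Jr; apply: (@eq_is_derive_eq R (fun r => x_e' (c r) j) (fun r => x_e' (d r) j)
    (fun r => x_e' (thetaV lam (c r) (v r)) j) J iJ _ _ s r Js Jr); last by rewrite e.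
    by move=> q Jq; have [_ _ _ +] := is_derive_coords (hc _ Jq).
  move=> q Jq; have [_ _ _ +] := is_derive_coords (hd _ Jq) => /(_ j).
  by rewrite !x_e'_mk m1.
have m0 r : J r -> x_0 (c r) = x_0 (d r).
  move=> Jr; apply: (@eq_is_derive_eq R (fun r => x_0 (c r)) (fun r => x_0 (d r))
    (fun r => x_0 (thetaV lam (c r) (v r))) J iJ _ _ s r Js Jr); last by rewrite e.
    by move=> q Jq; have [_ + _ _] := is_derive_coords (hc _ Jq).
  move=> q Jq; have [_ + _ _] := is_derive_coords (hd _ Jq).
  have -> // : x_0 (thetaV lam (d q) (v q)) = x_0 (thetaV lam (c q) (v q)).
  rewrite !x_0_mk m1//; congr (_ + _ * _).
  by apply: eq_bigr => j _; rewrite me// me'.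
by apply: osc_eqP => [||j|j]; [exact: m1|exact: m0|exact: me|exact: me'].
Qed.

End Reconstruction.

(** * Completeness of the metric from global Euler solutions *)

Section Completeness.
Context {R : realType} {n : nat}.
Variables (lam : 'I_n -> R) (u : {linear osc R n -> osc R n}) (w_inv : osc R n -> osc R n).
Hypothesis lam0 : forall j, 0 < lam j.
Hypothesis usym : k_symmetric lam u.
Hypotheses (uK : cancel u w_inv) (Ku : cancel w_inv u).

Lemma inverse_linear : linear w_inv.
Proof. by move=> k x y; apply: (can_inj uK); rewrite linearP !Ku. Qed.

Lemma is_derive_derive1 {V : normedModType R} (f : R -> V) (t : R) :
  derivable f t 1 -> is_derive t 1 f (derive1 f t).
Proof. by move=> h; split=> //; rewrite derive1E. Qed.

Lemma is_derive_unique {V : normedModType R} (f : R -> V) (t : R) (d d' : V) :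
  is_derive t 1 f d -> is_derive t 1 f d' -> d = d'.
Proof. by move=> [_ <-] [_ <-]. Qed.

Let ubij : bijective u := Bijective uK Ku.

Lemma geodesic_euler I c : geodesic_on (ku_metric lam u) I c ->
  let v t := theta lam (c t) (derive1 c t) in
  forall t : R, I t -> is_derive t 1 c (thetaV lam (c t) (v t)) /\
    is_derive t 1 (fun t => u (v t)) (lie lam (u (v t)) (w_inv (u (v t)))).
Proof.
move=> geo v t It; have [d1 d2 eqn] := geo _ It.
have dc := is_derive_derive1 d1; have ddc := is_derive_derive1 d2.
split; first by rewrite /v thetaK.
have /(geodesic_equation_euler lam0 ubij usym) e := eqn.
rewrite uK -e; apply: linear_is_derive; first exact: linearP.
exact: (is_derive_theta lam dc ddc).
Qed.

Lemma euler_geodesic (v : R -> osc R n) c :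
  (forall t : R, is_derive t 1 (fun t => u (v t)) (lie lam (u (v t)) (v t))) ->
  (forall t : R, is_derive t 1 c (thetaV lam (c t) (v t))) ->
  geodesic_on (ku_metric lam u) setT c.
Proof.
move=> duv dc t _.
have c1E : derive1 c = (fun t => thetaV lam (c t) (v t)).
  by apply/funext => s; rewrite derive1E; have [_ ->] := dc s.
have dv (s : R) : is_derive s 1 v (w_inv (lie lam (u (v s)) (v s))).
  have := linear_is_derive inverse_linear (duv s).
  by have -> : (fun q => w_inv (u (v q))) = v by apply/funext => q; rewrite uK.
have d2 : derivable (derive1 c) t 1.
  by rewrite c1E; exact: derivable_thetaV (dc t) (dv t).
split; [by case: (dc t)|exact: d2|].
apply/(geodesic_equation_euler lam0 ubij usym).
have dc' : is_derive t 1 c (derive1 c t) by rewrite c1E.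
have := is_derive_theta lam dc' (is_derive_derive1 d2).
have -> : (fun s => theta lam (c s) (derive1 c s)) = v.
  by apply/funext => s; rewrite c1E thetaVK.
(* The derivative of [v] obtained by differentiating [theta (c) (c')] must equal the one given by
   the Euler equation. *)
move=> /is_derive_unique/(_ (dv t)) ->.
by rewrite Ku c1E thetaVK.
Qed.

Lemma geodesically_complete_of_euler :
  (forall (w0 : osc R n) (t0 : R), exists w : R -> osc R n, w t0 = w0 /\
     forall t : R, is_derive t 1 w (lie lam (w t) (w_inv (w t)))) ->
  geodesically_complete (ku_metric lam u).
Proof.
move=> glob I c oI iI geo.
have from t0 p0 v0 : exists d, [/\ geodesic_on (ku_metric lam u) setT d,
    d t0 = p0 & theta lam (d t0) (derive1 d t0) = v0].
  have [w [w0 dw]] := glob (u v0) t0.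
  pose v t := w_inv (w t).
  have wE : (fun t => u (v t)) = w by apply/funext => t; exact: Ku.
  have [d [d0 dd]] := position_exists lam t0 p0
    (fun t => linear_is_derive inverse_linear (dw t)).
  exists d; split; [|exact: d0|].
    apply: (@euler_geodesic v _ _ dd) => t.
    by rewrite wE /v Ku.
  by rewrite derive1E; have [_ ->] := dd t0; rewrite thetaVK w0 uK.
(* On an empty interval any global geodesic qualifies, but one must still be exhibited. *)
have [[t0 It0]|I0] := pselect (exists t, I t); last first.
  have [d [hd _ _]] := from 0 0 0; exists d; split; first exact: hd.
  by move=> t It; case: I0; exists t.
have [d [hd d0 d1]] := from t0 (c t0) (theta lam (c t0) (derive1 c t0)).
exists d; split; first exact: hd.
move=> t It; apply/esym.
have hcE := geodesic_euler geo; have hdE t := geodesic_euler hd (t := t) Logic.I.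
(* Uniqueness goes in two stages: first the velocities at the identity, by the Euler equation, then
   the positions they determine. *)
have vE s : I s -> theta lam (c s) (derive1 c s) = theta lam (d s) (derive1 d s).
  move=> Is; apply: (can_inj uK).
  apply: (@ode_unique R _ (fun w => lie lam w (w_inv w))
    (fun s => u (theta lam (c s) (derive1 c s))) (fun s => u (theta lam (d s) (derive1 d s)))
    I (euler_locally_lipschitz lam inverse_linear) iI _ _ t0 s It0 Is).
  - by move=> r Ir; have [] := hcE _ Ir.
  - by move=> r Ir; have [] := hdE r.
  - by rewrite d1.
apply: (@position_unique R n lam I (fun s => theta lam (c s) (derive1 c s)) c d iI _ _ t0 t It0 It).
- by move=> r Ir; have [] := hcE _ Ir.
- by move=> r Ir; have [h _] := hdE r; rewrite (vE r Ir); exact: h.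
- exact/esym.
Qed.

End Completeness.

(** * Center, derived ideal and Cartan subalgebras *)

Section Structure.
Context {R : realType} {n : nat}.
Variable lam : 'I_n -> R.
Hypothesis lam0 : forall j, 0 < lam j.
Implicit Types (x y z : osc R n) (U V h : {vspace osc R n}).

Definition e_m1 : osc R n := mkosc 1 0 (fun=> 0) (fun=> 0).

Lemma lie_m1 x y : x_m1 (lie lam x y) = 0.
Proof. by rewrite x_m1_mk. Qed.

Lemma lie_e_0 x : lie lam x e_0 = 0.
Proof.
apply: osc_eqP => [||j|j]; rewrite coordE !mkE; try ring.
by rewrite big1// => j _; rewrite !mkE; ring.
Qed.

Lemma lie_heisenberg x y : x_m1 x = 0 -> x_m1 y = 0 ->
  lie lam x y = x_0 (lie lam x y) *: e_0.
Proof.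
by move=> x1 y1; apply: osc_eqP => [||j|j]; rewrite coordE !mkE ?x1 ?y1; ring.
Qed.

Lemma mem_lie_vs U V x y : x \in U -> y \in V -> lie lam x y \in lie_vs lam U V.
Proof.
move=> xU yV; rewrite (coord_vbasis xU) (linear_sum_scale _ _ (lie_linearl lam y)).
apply: rpred_sum => i _; apply: rpredZ.
rewrite (coord_vbasis yV) (linear_sum_scale _ _ (lie_linear lam _)).
apply: rpred_sum => j _; apply: rpredZ; apply: memv_span.
by apply: allpairs_f; apply: mem_nth; rewrite size_tuple.
Qed.

Lemma lie_vs_m1 U V x : x \in lie_vs lam U V -> x_m1 x = 0.
Proof.
set s := [seq lie lam a b | a <- vbasis U, b <- vbasis V] => xs.
have := coord_span (X := in_tuple s) xs => ->.
have lm1 : linear (@x_m1 R n : osc R n -> R^o) by move=> k a b; rewrite !coordE.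
rewrite (linear_sum_scale _ _ lm1) big1// => i _.
have /allpairsP[[a b] [_ _ ->]] : (in_tuple s)`_i \in s by exact: mem_nth.
by rewrite lie_m1 scaler0.
Qed.

Lemma mem_derived_ideal x : (0 < n)%N -> (x \in derived_ideal lam) = (x_m1 x == 0).
Proof.
move=> n0; apply/idP/eqP => [|x1]; first exact: lie_vs_m1.
pose j0 := Ordinal n0.
(* [ad e_m1] is invertible on the complex planes, and [a] is the preimage of the complex part of
   [x]. The bracket of [d] and [d'] is [e_0]; this is where a first plane [j0] is used. *)
pose a : osc R n := mkosc 0 0 (fun j => x_e' x j / lam j) (fun j => - (x_e x j / lam j)).
pose d : osc R n := mkosc 0 0 (fun j => (j == j0)%:R) (fun=> 0).
pose d' : osc R n := mkosc 0 0 (fun=> 0) (fun j => (j == j0)%:R).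
have -> : x = lie lam e_m1 a + x_0 x *: lie lam d d'.
  apply: osc_eqP => [||j|j]; rewrite !coordE !mkE.
  - by rewrite x1; ring.
  - rewrite big1 ?add0r => [|j _]; last by rewrite !mkE; ring.
    rewrite (bigD1 j0)//= big1 ?addr0 => [|j jj]; rewrite !mkE.
      by rewrite eqxx !mulr1 mulr0 subr0 mulr1.
    by rewrite (negbTE jj) mulr0n; ring.
  - by field; rewrite gt_eqF.
  - by field; rewrite gt_eqF.
by rewrite rpredD ?rpredZ// mem_lie_vs ?memvf.
Qed.

Lemma lie_center_mem x : (0 < n)%N -> lie_center lam x -> x = x_0 x *: e_0.
Proof.
move=> n0 hx; pose j0 := Ordinal n0.
have he i : x_e x i = 0.
  have := congr1 (@x_0 R n) (hx (mkosc 0 0 (fun=> 0) (fun j => (j == i)%:R))).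
  rewrite coordE !mkE (bigD1 i)//= big1 ?addr0 => [|j ji]; rewrite !mkE.
    by rewrite eqxx mulr1 mulr0 subr0.
  by rewrite (negbTE ji) mulr0n; ring.
have he' i : x_e' x i = 0.
  have := congr1 (@x_0 R n) (hx (mkosc 0 0 (fun j => (j == i)%:R) (fun=> 0))).
  rewrite coordE !mkE (bigD1 i)//= big1 ?addr0 => [|j ji]; rewrite !mkE.
    by rewrite eqxx mulr1 mulr0 sub0r => /eqP; rewrite oppr_eq0 => /eqP.
  by rewrite (negbTE ji) mulr0n; ring.
have hm : x_m1 x = 0.
  have := congr1 (fun z => x_e' z j0) (hx (mkosc 0 0 (fun j => (j == j0)%:R) (fun=> 0))).
  rewrite /= coordE !mkE eqxx mulr1 mulr0 subr0 => /eqP.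
  by rewrite mulf_eq0 gt_eqF//= => /eqP.
by apply: osc_eqP => [||j|j]; rewrite coordE !mkE ?hm ?he ?he'; ring.
Qed.

Lemma e_0_center : lie_center lam e_0.
Proof. by move=> y; rewrite lieC lie_e_0 oppr0. Qed.

Section Cartan.
Variable h : {vspace osc R n}.
Hypothesis hC : cartan_subalgebra lam h.

Lemma cartan_normal x : (forall y, y \in h -> lie lam x y \in h) -> x \in h.
Proof.
have [_ _ hN] := hC => hx.
have : lie_normalizer lam h x by [].
by rewrite hN.
Qed.

Lemma cartan_e_0 : e_0 \in h.
Proof. by apply: cartan_normal => y _; rewrite e_0_center mem0v. Qed.

(** Were [h] inside the Heisenberg ideal, every element of that ideal would bracket [h] into
    multiples of [e_0], hence into [h]. Self-normalisation would give the whole ideal, and then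
    [e_m1], which normalises it: a contradiction. *)
Lemma cartan_not_heisenberg : exists2 x, x \in h & x_m1 x != 0.
Proof.
apply: contrapT => hn.
have h1 x : x \in h -> x_m1 x = 0.
  by move=> xh; apply/eqP; apply: contrapT => /negP x1; apply: hn; exists x.
have h2 x : x_m1 x = 0 -> x \in h.
  move=> x1; apply: cartan_normal => y /h1 y1.
  by rewrite lie_heisenberg// rpredZ// cartan_e_0.
have : e_m1 \in h by apply: cartan_normal => y _; apply: h2; exact: lie_m1.
by move/h1/eqP; rewrite x_m1_mk oner_eq0.
Qed.

(* [ad x] acts invertibly on the coordinates along the complex planes, while
   it is nilpotent on [h]. *)
Lemma cartan_heisenberg y : y \in h -> x_m1 y = 0 ->
  forall j, x_e y j = 0 /\ x_e' y j = 0.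
Proof.
move=> yh y1 j; have [x xh x1] := cartan_not_heisenberg.
have [_ [k hk] _] := hC.
have mem i : iter i (lie lam x) y \in iter i (lie_vs lam h) h.
  by elim: i => //= i ih; exact: mem_lie_vs.
have : x_e (iter k (lie lam x) y) j = 0 /\ x_e' (iter k (lie lam x) y) j = 0.
  by have := mem k; rewrite hk memv0 => /eqP ->; rewrite !coordE.
elim: k y {yh hk mem} y1 => [|k ih] y y1 //; rewrite iterSr => /(ih _ (lie_m1 _ _)).
rewrite !mkE y1 !mulr0 !subr0 => -[/eqP + /eqP].
rewrite !mulf_eq0 oppr_eq0 gt_eqF//= (negbTE x1)/=.
by move=> /eqP -> /eqP ->.
Qed.

(** An injective map sending the finite-dimensional [h] into itself is onto [h], so [e_0] has its
    preimage there. *)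
Lemma cartan_stable_inverse (u : {linear osc R n -> osc R n}) w_inv :
  cancel u w_inv -> leaves_stable u [set` h] -> w_inv e_0 \in h.
Proof.
move=> uK uh; pose f : 'End(osc R n) := linfun u.
have fE x : f x = u x by rewrite lfunE.
have f_inj : lker f == 0%VS.
  by apply/lker0P => x y; rewrite !fE; exact: (can_inj uK).
have fh : (f @: h <= h)%VS.
  by apply/subvP => _ /memv_imgP[x xh ->]; rewrite fE; apply: uh; exists x.
have /eqP fhE : (f @: h == h)%VS.
  rewrite eqEdim fh /=.
  by rewrite limg_dim_eq ?(eqP f_inj) ?capv0.
have := cartan_e_0; rewrite -{1}fhE => /memv_imgP[y yh e0E].
by rewrite e0E fE uK.
Qed.

End Cartan.

End Structure.

Theorem mainTheorem1 (R : realType) (n : nat) (lam : 'I_n -> R)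
    (u : {linear osc R n -> osc R n}) :
  (1 <= n)%N ->
  (forall j, 0 < lam j) ->
  (forall i j : 'I_n, (i <= j)%N -> lam i <= lam j) ->
  bijective u ->
  k_symmetric lam u ->
  (leaves_stable u (lie_center lam) ->
     leaves_stable u [set` derived_ideal lam]) /\
  (leaves_stable u (lie_center lam) \/
   (exists h : {vspace osc R n},
      cartan_subalgebra lam h /\ leaves_stable u [set` h]) ->
   geodesically_complete (ku_metric lam u)).
Proof.
move=> n1 lam0 _ [w_inv uK Ku] usym.
have u_e_0 : leaves_stable u (lie_center lam) -> u e_0 = x_0 (u e_0) *: e_0.
  move=> hu; apply: lie_center_mem => //; apply: hu.
  by exists e_0 => //; exact: e_0_center.
split=> [/u_e_0 ue0 _ [x xD <-]|hu].
  (* The derived ideal is the orthogonal of [e_0], so the symmetry of [u] transfers stability from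
     the center to it. *)
  have kE y : kform lam y e_0 = x_m1 y.
    rewrite /kform !mkE big1 => [|j _]; last by rewrite !mkE; ring.
    by ring.
  move: xD; rewrite /= !mem_derived_ideal// => /eqP x1.
  rewrite -kE usym ue0 -[_ *: _]addr0.
  rewrite (kform_linear lam x (x_0 (u e_0)) e_0 0) kE x1 scaler0 add0r.
  rewrite /kform !coordE !mulr0 big1 ?addr0// => j _.
  by rewrite !coordE; ring.
have [X hX] : exists X : osc R n, forall j,
    x_e (w_inv e_0) j = x_m1 (w_inv e_0) * x_e X j /\
    x_e' (w_inv e_0) j = x_m1 (w_inv e_0) * x_e' X j.
  have [f1|f1] := eqVneq (x_m1 (w_inv e_0)) 0; last first.
    exists ((x_m1 (w_inv e_0))^-1 *: w_inv e_0) => j.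
    by rewrite !coordE !mulrA mulfV// !mul1r.
  (* With [X = 0] the complex part of [w_inv e_0] has to vanish. For a stable center, [w_inv e_0] is
     a multiple of [e_0]; for a stable Cartan subalgebra, it lies in [h] and in the Heisenberg
     ideal. *)
  exists 0 => j; rewrite f1 !mul0r; case: hu => [/u_e_0 ue0|[h [hC uh]]].
    have a0 : x_0 (u e_0) != 0.
      apply/eqP => a0; have := uK e_0; rewrite ue0 a0 scale0r -(linear0 u) uK.
      by move/(congr1 (@x_0 R n))/eqP; rewrite coordE !mkE eq_sym oner_eq0.
    have -> : w_inv e_0 = (x_0 (u e_0))^-1 *: e_0.
      by apply: (can_inj uK); rewrite Ku linearZ /= {2}ue0 scalerA mulVf// scale1r.
    by rewrite !coordE !mkE mulr0.
  by apply: (cartan_heisenberg lam0 hC) => //; exact: (cartan_stable_inverse hC uK uh).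
apply: (geodesically_complete_of_euler lam0 usym uK Ku) => w0 t0.
exact: (euler_global lam (inverse_linear uK Ku) hX w0 t0).
Qed.
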